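(* Let $(A, u, \eta, \Delta, \varepsilon, S, \{\cdot,\cdot\}, d)$ be a DG Poisson Hopf algebra over $\Bbbk$ (with Poisson bracket of degree $0$), let $(A^e,m,h,d^e)$ be the universal enveloping algebra of the DG Poisson algebra $(A,\{\cdot,\cdot\},d)$, with multiplication $u^e$ and unit $\eta^e$, and let $A^{eop}$ be the DG opposite algebra of $A^e$. Let $\Delta^e:A^e\to A^e\otimes A^e$ and $\varepsilon^e:A^e\to\Bbbk$ be the DG algebra homomorphisms determined by $\Delta^em=(m\otimes m)\Delta$, $\Delta^eh=(m\otimes h+h\otimes m)\Delta$, $\varepsilon^em=\varepsilon$, $\varepsilon^eh=0$. Then: (1) There exists a DG algebra homomorphism $S^e:A^e\to A^{eop}$ such that $S^em=mS$ and $S^eh=hS$. (2) One has $\{S(a_{(1)}),a_{(2)}\}=0$ for all $a\in A$ (where $\Delta(a)=a_{(1)}\otimes a_{(2)}$) if and only if $(A^e,u^e,\eta^e,\Delta^e,\varepsilon^e,S^e,d^e)$ is a DG Hopf algebra.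
   Context: Conventions: $\Bbbk$ is a field of characteristic zero; all gradings are $\mathbb{Z}$-gradings; algebras are associative with identity; $|a|$ is the degree of a homogeneous element $a$; the tensor product of graded algebras has multiplication $(a\otimes b)(a'\otimes b')=(-1)^{|a'||b|}aa'\otimes bb'$; the twisting map is $T(v\otimes w)=(-1)^{|v||w|}w\otimes v$; $I$ is the identity map. Sweedler notation $\Delta(a)=a_{(1)}\otimes a_{(2)}$ omits the summation sign, and an expression such as $\{S(a_{(1)}),a_{(2)}\}$ denotes the corresponding sum. The Poisson brackets have degree $0$. DG algebra: a graded algebra with a $\Bbbk$-linear map $d$ of degree $1$ such that $d^2=0$ and $d(ab)=d(a)b+(-1)^{|a|}a\,d(b)$. A DG algebra map (homomorphism) is a degree $0$ graded algebra map commuting with differentials. The field $\Bbbk$ has zero differential; on a tensor product, $d(a\otimes b)=d(a)\otimes b+(-1)^{|a|}a\otimes d(b)$. The DG opposite algebra $B^{op}$ of a DG algebra $B$ has the same underlying graded space and differential, with multiplication $a\circ b=(-1)^{|a||b|}ba$; $A^{eop}$ means $(A^e)^{op}$. DG Poisson algebra: a graded algebra $A$ with a $\Bbbk$-linear bracket $\{\cdot,\cdot\}:A\otimes A\to A$ of degree $0$ and a $\Bbbk$-linear map $d$ of degree $1$ with $d^2=0$ such that for all homogeneous $a,b,c$: $\{a,b\}=-(-1)^{|a||b|}\{b,a\}$; $\{a,\{b,c\}\}=\{\{a,b\},c\}+(-1)^{|a||b|}\{b,\{a,c\}\}$; $ab=(-1)^{|a||b|}ba$; $\{a,bc\}=\{a,b\}c+(-1)^{|a||b|}b\{a,c\}$;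 $d(\{a,b\})=\{d(a),b\}+(-1)^{|a|}\{a,d(b)\}$; $d(ab)=d(a)b+(-1)^{|a|}a\,d(b)$. Graded bialgebra: a graded algebra $(H,u,\eta)$ which is also a graded coalgebra $(H,\Delta,\varepsilon)$ (coassociative and counital, $\Delta,\varepsilon$ of degree $0$) such that $\Delta$ and $\varepsilon$ are graded algebra homomorphisms. It is a graded Hopf algebra with antipode $S$ if $S:H\to H$ is a linear map of degree $0$ with $u(I\otimes S)\Delta=u(S\otimes I)\Delta=\eta\varepsilon$. A DG bialgebra is a graded bialgebra $H$ with a $\Bbbk$-linear map $d$ of degree $1$, $d^2=0$, such that $d$ is a derivation ($d(ab)=d(a)b+(-1)^{|a|}a\,d(b)$) and a coderivation ($\varepsilon d=0$ and $\Delta d=(d\otimes I+T(d\otimes I)T)\Delta$). A DG Hopf algebra $(H,u,\eta,\Delta,\varepsilon,S,d)$ is a DG bialgebra such that $(H,u,\eta,\Delta,\varepsilon,S)$ is a graded Hopf algebra. DG Poisson Hopf algebra $(A,u,\eta,\Delta,\varepsilon,S,\{\cdot,\cdot\},d)$: $(A,u,\eta,\{\cdot,\cdot\},d)$ is a DG Poisson algebra; $(A,u,\eta,\Delta,\varepsilon)$ is a graded bialgebra; $\Delta(\{a,b\})=\{\Delta(a),\Delta(b)\}_{A\otimes A}$ where $\{a\otimes a',b\otimes b'\}_{A\otimes A}=(-1)^{|b||a'|}(\{a,b\}\otimes a'b'+ab\otimes\{a',b'\})$; $\varepsilon d=0$ and $\Delta d(a)=d(a_{(1)})\otimes a_{(2)}+(-1)^{|a_{(1)}|}a_{(1)}\otimes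 d(a_{(2)})$; and $S:A\to A$ is a linear map of degree $0$ with $u(I\otimes S)\Delta=u(S\otimes I)\Delta=\eta\varepsilon$. Universal enveloping algebra of a DG Poisson algebra $A$: a quadruple $(A^e,m,h,d^e)$ where $(A^e,d^e)$ is a DG algebra, $m:A\to A^e$ is a DG algebra map, $h:A\to A^e$ is a DG Lie algebra map (i.e. $h$ is linear of degree $0$, $d^eh=hd$, and $h(\{a,b\})=h(a)h(b)-(-1)^{|a||b|}h(b)h(a)$), satisfying $m(\{a,b\})=h(a)m(b)-(-1)^{|a||b|}m(b)h(a)$ and $h(ab)=m(a)h(b)+(-1)^{|a||b|}m(b)h(a)$ for homogeneous $a,b$, and universal: for every DG algebra $(D,\delta)$, DG algebra map $f:A\to D$ and DG Lie algebra map $g:A\to D$ (with $D$ carrying the graded commutator) with $f(\{a,b\})=g(a)f(b)-(-1)^{|a||b|}f(b)g(a)$ and $g(ab)=f(a)g(b)+(-1)^{|a||b|}f(b)g(a)$, there is a unique DG algebra map $\phi:A^e\to D$ with $\phi m=f$ and $\phi h=g$. Such an $A^e$ exists, is unique up to isomorphism, and is generated as an algebra by $m(A)$ and $h(A)$; hence maps satisfying the formulas in the claim are determined by them. The maps $\Delta^e$ and $\varepsilon^e$ exist and make $A^e$ a DG bialgebra. *)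

(* Defs.v *)
From HB Require Import structures.
From mathcomp Require Import all_boot all_order all_algebra.
From mathcomp Require Import generic_quotient sesquilinear boolp.
From mathcomp Require classical_sets.

Set Implicit Arguments.
Unset Strict Implicit.
Unset Printing Implicit Defensive.

Import Order.TTheory GRing.Theory Num.Theory.
Local Open Scope ring_scope.
Local Open Scope quotient_scope.

Reserved Notation "v ⊗ w" (at level 40, left associativity).

Notation is_bilinear f := (bilinear_for *:%R *:%R f).

(* Tensor product over a field: a list of pairs (v, w) stands for the formal  *)
(* sum of the v ⊗ w, and two lists are identified when they agree under every *)
(* bilinear map. The universal property is tlift_pure and tensor_ext.         *)
Section Tensor.
Variables (k : fieldType) (V W : lmodType k).

Definition formal_eval (U : lmodType k) (f : V -> W -> U) (s : seq (V * W)) : U :=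
  \sum_(p <- s) f p.1 p.2.

Definition formal_eq : rel (seq (V * W)) := fun s t =>
  `[< forall (U : lmodType k) (f : V -> W -> U), is_bilinear f ->
        formal_eval f s = formal_eval f t >].

Fact formal_eq_refl : reflexive formal_eq.
Proof. by move=> s; apply/asboolP. Qed.

Fact formal_eq_sym : symmetric formal_eq.
Proof. by move=> s t; apply/asboolP/asboolP => H U f hf; rewrite (H U f hf). Qed.

Fact formal_eq_trans : transitive formal_eq.
Proof.
by move=> t s r /asboolP H /asboolP H'; apply/asboolP => U f hf; rewrite H ?H'.
Qed.

Canonical formal_equiv := EquivRel formal_eq formal_eq_refl formal_eq_sym formal_eq_trans.

Definition tensor := {eq_quot formal_equiv}.
HB.instance Definition _ := Choice.on tensor.
HB.instance Definition _ := EqQuotient.on tensor.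

Definition tlift (U : lmodType k) (f : V -> W -> U) (x : tensor) : U :=
  formal_eval f (repr x).

Lemma tlift_pi (U : lmodType k) (f : V -> W -> U) s : is_bilinear f ->
  tlift f (\pi_tensor s) = formal_eval f s.
Proof.
move=> hf; rewrite /tlift.
have /eqquotP/asboolP H : repr (\pi_tensor s) = s %[mod tensor] by rewrite reprK.
exact: H.
Qed.

Lemma tensor_eqP (s t : seq (V * W)) :
  (forall (U : lmodType k) (f : V -> W -> U), is_bilinear f ->
     formal_eval f s = formal_eval f t) -> \pi_tensor s = \pi_tensor t.
Proof. by move=> H; apply/eqquotP/asboolP. Qed.

Lemma formal_eval_cat (U : lmodType k) (f : V -> W -> U) s t :
  formal_eval f (s ++ t) = formal_eval f s + formal_eval f t.
Proof. exact: big_cat. Qed.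

Definition formal_scale (c : k) (s : seq (V * W)) := [seq (c *: p.1, p.2) | p <- s].

Lemma formal_eval_scale (U : lmodType k) (f : V -> W -> U) c s : is_bilinear f ->
  formal_eval f (formal_scale c s) = c *: formal_eval f s.
Proof.
move=> [hf _]; rewrite /formal_eval /formal_scale big_map scaler_sumr.
by apply: eq_bigr => p _ /=; have := scalable_linear (hf p.2) => /(_ c p.1).
Qed.

Definition tensor_zero : tensor := \pi_tensor [::].
Definition tensor_add (x y : tensor) : tensor := \pi_tensor (repr x ++ repr y).
Definition tensor_scale c (x : tensor) : tensor := \pi_tensor (formal_scale c (repr x)).
Definition tensor_opp (x : tensor) : tensor := tensor_scale (-1) x.

Lemma tensorP (x y : tensor) :
  (forall (U : lmodType k) (f : V -> W -> U), is_bilinear f -> tlift f x = tlift f y) -> x = y.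
Proof. by move=> H; rewrite -[x]reprK -[y]reprK; apply: tensor_eqP => U f /H. Qed.

Fact tlift_add (U : lmodType k) (f : V -> W -> U) x y : is_bilinear f ->
  tlift f (tensor_add x y) = tlift f x + tlift f y.
Proof. by move=> hf; rewrite /tensor_add tlift_pi // formal_eval_cat. Qed.

Fact tlift_scale (U : lmodType k) (f : V -> W -> U) c x : is_bilinear f ->
  tlift f (tensor_scale c x) = c *: tlift f x.
Proof. by move=> hf; rewrite /tensor_scale tlift_pi // formal_eval_scale. Qed.

Fact tlift_zero (U : lmodType k) (f : V -> W -> U) : is_bilinear f ->
  tlift f tensor_zero = 0.
Proof. by move=> hf; rewrite /tensor_zero tlift_pi // /formal_eval big_nil. Qed.

Fact tensor_addA : associative tensor_add.
Proof. by move=> x y z; apply: tensorP => U f hf; rewrite !tlift_add // addrA. Qed.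
Fact tensor_addC : commutative tensor_add.
Proof. by move=> x y; apply: tensorP => U f hf; rewrite !tlift_add // addrC. Qed.
Fact tensor_add0 : left_id tensor_zero tensor_add.
Proof. by move=> x; apply: tensorP => U f hf; rewrite !tlift_add // tlift_zero // add0r. Qed.
Fact tensor_addN : left_inverse tensor_zero tensor_opp tensor_add.
Proof.
move=> x; apply: tensorP => U f hf.
by rewrite tlift_add // tlift_scale // tlift_zero // scaleN1r addNr.
Qed.
HB.instance Definition _ :=
  GRing.isZmodule.Build tensor tensor_addA tensor_addC tensor_add0 tensor_addN.

Fact tensor_scaleA a b x : tensor_scale a (tensor_scale b x) = tensor_scale (a * b) x.
Proof. by apply: tensorP => U f hf; rewrite !tlift_scale // scalerA. Qed.
Fact tensor_scale1 : left_id 1 tensor_scale.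
Proof. by move=> x; apply: tensorP => U f hf; rewrite !tlift_scale // scale1r. Qed.
Fact tensor_scaleDr : right_distributive tensor_scale +%R.
Proof.
by move=> a x y; apply: tensorP => U f hf; rewrite !(tlift_scale, tlift_add) // scalerDr.
Qed.
Fact tensor_scaleDl x : {morph tensor_scale^~ x : a b / a + b}.
Proof.
by move=> a b; apply: tensorP => U f hf; rewrite !(tlift_scale, tlift_add) // scalerDl.
Qed.
HB.instance Definition _ := GRing.Zmodule_isLmodule.Build k tensor
  tensor_scaleA tensor_scale1 tensor_scaleDr tensor_scaleDl.

Definition pure (v : V) (w : W) : tensor := \pi_tensor [:: (v, w)].

Lemma tlift_pure (U : lmodType k) (f : V -> W -> U) v w : is_bilinear f ->
  tlift f (pure v w) = f v w.
Proof. by move=> hf; rewrite tlift_pi // /formal_eval big_seq1. Qed.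

Lemma tlift_is_linear (U : lmodType k) (f : V -> W -> U) : is_bilinear f -> linear (tlift f).
Proof. by move=> hf c x y; rewrite tlift_add // tlift_scale. Qed.

Lemma pure_bilinear : is_bilinear pure.
Proof.
by split=> [w c v v'|v c w w'] /=; apply: tensorP => U f hf;
  rewrite [RHS]tlift_add // tlift_scale // !tlift_pure //; have [hl hr] := hf;
  rewrite ?hl ?hr.
Qed.

Lemma tensor_ind (P : tensor -> Prop) :
  (forall v w, P (pure v w)) -> (forall x y, P x -> P y -> P (x + y)) ->
  forall x, P x.
Proof.
move=> Pp Pa x; rewrite -[x]reprK; elim: (repr x) => [|[v w] s IH].
  have -> : \pi_tensor [::] = pure 0 0; last exact: Pp.
  apply: tensorP => U f hf; rewrite tlift_pure // tlift_zero //.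
  by have [hl _] := hf; have := scalable_linear (hl 0) => /(_ 0 0) /=; rewrite !scale0r.
have -> : \pi_tensor ((v, w) :: s) = pure v w + \pi_tensor s; last exact: Pa.
apply: tensorP => U f hf; rewrite [RHS]tlift_add // tlift_pure // !tlift_pi //.
by rewrite /formal_eval big_cons.
Qed.

Lemma tensor_ext (U : lmodType k) (f g : {linear tensor -> U}) :
  (forall v w, f (pure v w) = g (pure v w)) -> f =1 g.
Proof. by move=> H; elim/tensor_ind => [//|x y Hx Hy]; rewrite !linearD Hx Hy. Qed.

End Tensor.

Notation "V ⊗ W" := (tensor V%type W%type) : type_scope.
Notation "v ⊗ w" := (pure v w) : ring_scope.

Section PureTheory.
Variables (k : fieldType) (V W : lmodType k).
Implicit Types (v : V) (w : W).

Lemma pureDl v v' w : (v + v') ⊗ w = v ⊗ w + v' ⊗ w.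
Proof. by have := (pure_bilinear V W).1 w 1 v v'; rewrite /= !scale1r. Qed.
Lemma pureDr v w w' : v ⊗ (w + w') = v ⊗ w + v ⊗ w'.
Proof. by have := (pure_bilinear V W).2 v 1 w w'; rewrite /= !scale1r. Qed.
Lemma pure0l w : (0 : V) ⊗ w = 0.
Proof. by apply: (addrI ((0 : V) ⊗ w)); rewrite -pureDl !addr0. Qed.
Lemma pure0r v : v ⊗ (0 : W) = 0.
Proof. by apply: (addrI (v ⊗ (0 : W))); rewrite -pureDr !addr0. Qed.
Lemma pureZl c v w : (c *: v) ⊗ w = c *: (v ⊗ w).
Proof. by have := (pure_bilinear V W).1 w c v 0; rewrite /= !addr0 pure0l addr0. Qed.
Lemma pureZr c v w : v ⊗ (c *: w) = c *: (v ⊗ w).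
Proof. by have := (pure_bilinear V W).2 v c w 0; rewrite /= !addr0 pure0r addr0. Qed.
Lemma pure_suml I (r : seq I) (P : pred I) (F : I -> V) w :
  (\sum_(i <- r | P i) F i) ⊗ w = \sum_(i <- r | P i) (F i ⊗ w).
Proof. by apply: (big_morph (fun v => v ⊗ w)) => [v v'|]; rewrite ?pureDl ?pure0l. Qed.
Lemma pure_sumr I (r : seq I) (P : pred I) (F : I -> W) v :
  v ⊗ (\sum_(i <- r | P i) F i) = \sum_(i <- r | P i) (v ⊗ F i).
Proof. by apply: (big_morph (fun w => v ⊗ w)) => [w w'|]; rewrite ?pureDr ?pure0r. Qed.

End PureTheory.

Section TensorMaps.
Variable k : fieldType.

Definition tmap (V V' W W' : lmodType k) (f : V -> V') (g : W -> W') : V ⊗ W -> V' ⊗ W' :=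
  tlift (fun v w => f v ⊗ g w).

Section TMap.
Variables (V V' W W' : lmodType k) (f : {linear V -> V'}) (g : {linear W -> W'}).

Fact tmap_bilinear : is_bilinear (fun v w => f v ⊗ g w).
Proof.
by split=> [w|v] c x y /=; rewrite linearP ?pureDl ?pureDr ?pureZl ?pureZr.
Qed.
HB.instance Definition _ :=
  GRing.isLinear.Build k _ _ *:%R (tmap f g) (tlift_is_linear tmap_bilinear).

Lemma tmapE v w : tmap f g (v ⊗ w) = f v ⊗ g w.
Proof. exact: tlift_pure tmap_bilinear. Qed.
End TMap.

(* The canonical isomorphisms (U ⊗ V) ⊗ W -> U ⊗ (V ⊗ W) and back.            *)
Section Assoc.
Variables U V W : lmodType k.

Fact tassoc_bilinear1 (w : W) : is_bilinear (fun (u : U) (v : V) => u ⊗ (v ⊗ w)).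
Proof.
by split=> [v|u] c x y /=; rewrite ?(pureDl, pureDr, pureZl, pureZr).
Qed.
Definition tassoc : (U ⊗ V) ⊗ W -> U ⊗ (V ⊗ W) :=
  tlift (fun (x : U ⊗ V) (w : W) => tlift (fun (u : U) (v : V) => u ⊗ (v ⊗ w)) x).
Fact tassoc_bilinear : is_bilinear (fun (x : U ⊗ V) (w : W) =>
  tlift (fun (u : U) (v : V) => u ⊗ (v ⊗ w)) x).
Proof.
split=> [w|x] c; first exact: tlift_is_linear (tassoc_bilinear1 w) c.
move=> w w' /=; elim/tensor_ind: x => [u v|x y Hx Hy].
  rewrite !tlift_pure; do ?exact: tassoc_bilinear1.
  by rewrite ?(pureDl, pureDr, pureZl, pureZr).
have D z := tlift_add x y (tassoc_bilinear1 z).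
by rewrite !D Hx Hy scalerDr addrACA.
Qed.
HB.instance Definition _ :=
  GRing.isLinear.Build k _ _ *:%R tassoc (tlift_is_linear tassoc_bilinear).

Lemma tassocE u v w : tassoc ((u ⊗ v) ⊗ w) = u ⊗ (v ⊗ w).
Proof.
by rewrite /tassoc (tlift_pure _ _ tassoc_bilinear) (tlift_pure _ _ (tassoc_bilinear1 w)).
Qed.

Fact tassocV_bilinear1 (u : U) : is_bilinear (fun (v : V) (w : W) => (u ⊗ v : U ⊗ V) ⊗ w).
Proof.
by split=> [w|v] c x y /=; rewrite ?(pureDl, pureDr, pureZl, pureZr).
Qed.
Definition tassocV : U ⊗ (V ⊗ W) -> (U ⊗ V) ⊗ W :=
  tlift (fun (u : U) (x : V ⊗ W) => tlift (fun (v : V) (w : W) => (u ⊗ v) ⊗ w) x).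
Fact tassocV_bilinear : is_bilinear (fun (u : U) (x : V ⊗ W) =>
  tlift (fun (v : V) (w : W) => (u ⊗ v) ⊗ w) x).
Proof.
split=> [x|u] c; last exact: tlift_is_linear (tassocV_bilinear1 u) c.
move=> w w' /=; elim/tensor_ind: x => [u v|x y Hx Hy].
  rewrite !tlift_pure; do ?exact: tassocV_bilinear1.
  by rewrite ?(pureDl, pureDr, pureZl, pureZr).
have D z := tlift_add x y (tassocV_bilinear1 z).
by rewrite !D Hx Hy scalerDr addrACA.
Qed.
HB.instance Definition _ :=
  GRing.isLinear.Build k _ _ *:%R tassocV (tlift_is_linear tassocV_bilinear).

Lemma tassocVE u v w : tassocV (u ⊗ (v ⊗ w)) = (u ⊗ v) ⊗ w.
Proof.
by rewrite /tassocV (tlift_pure _ _ tassocV_bilinear) (tlift_pure _ _ (tassocV_bilinear1 u)).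
Qed.
End Assoc.

(* The canonical isomorphisms k ⊗ V -> V and V ⊗ k -> V.                      *)
Section Unit.
Variable V : lmodType k.

Definition tunitl : k^o ⊗ V -> V := tlift (fun (c : k^o) v => (c : k) *: v).
Fact tunitl_bilinear : is_bilinear (fun (c : k^o) (v : V) => (c : k) *: v).
Proof.
split=> [v c x y|x c v w] /=; first by rewrite scalerDl scalerA.
by rewrite scalerDr !scalerA mulrC.
Qed.
HB.instance Definition _ :=
  GRing.isLinear.Build k _ _ *:%R tunitl (tlift_is_linear tunitl_bilinear).
Lemma tunitlE (c : k) v : tunitl ((c : k^o) ⊗ v) = c *: v.
Proof. exact: tlift_pure tunitl_bilinear. Qed.

Definition tunitr : V ⊗ k^o -> V := tlift (fun v (c : k^o) => (c : k) *: v).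
Fact tunitr_bilinear : is_bilinear (fun (v : V) (c : k^o) => (c : k) *: v).
Proof.
split=> [x c v w|v c x y] /=; last by rewrite scalerDl scalerA.
by rewrite scalerDr !scalerA mulrC.
Qed.
HB.instance Definition _ :=
  GRing.isLinear.Build k _ _ *:%R tunitr (tlift_is_linear tunitr_bilinear).
Lemma tunitrE (c : k) v : tunitr (v ⊗ (c : k^o)) = c *: v.
Proof. exact: tlift_pure tunitr_bilinear. Qed.
End Unit.

End TensorMaps.

Lemma ex_linear_form (k : fieldType) (V : lmodType k) (v : V) : v != 0 ->
  exists2 phi : V -> k^o, linear phi & phi v = 1.
Proof.
move=> v0.
pose P (M : V -> Prop) := (forall c x y, M x -> M y -> M (c *: x + y)) /\ ~ M v.
have [F FP tF|M [[Mlin Mv] Mmax]] := @classical_sets.Zorn_bigcup V P.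
  split=> [c x y [X FX Xx] [Y FY Yy]|[X FX Xv]]; last by case: (FP X FX).
  case: (tF X Y FX FY) => sXY.
    by exists Y => //; case: (FP Y FY) => L _; apply: L => //; exact: sXY.
  by exists X => //; case: (FP X FX) => L _; apply: L => //; exact: sXY.
have M0 : M 0.
  apply: contrapT => nM0.
  have nM x : ~ M x by move=> Mx; apply: nM0; rewrite -[0](addNr x) -scaleN1r; exact: Mlin.
  apply: (Mmax (fun x => x = 0)); first by split=> [x /nM //|/(_ 0 erefl)].
  by split=> [c x y -> ->|/eqP]; [rewrite scaler0 addr0|rewrite (negbTE v0)].
have MZ c x : M x -> M (c *: x) by move=> Mx; rewrite -[c *: x]addr0; exact: Mlin.
have MD x y : M x -> M y -> M (x + y) by rewrite -{2}[x]scale1r; exact: Mlin.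
have Mdec x : exists c : k, M (x - c *: v).
  apply: contrapT => nx.
  pose N y := exists2 c : k, M (y - c *: x) & True.
  apply: (Mmax N).
    split=> [y My|sub]; first by exists 0; rewrite // scale0r subr0.
    have : N x by exists 1; rewrite // scale1r subrr.
    by move=> /sub Mx; apply: nx; exists 0; rewrite scale0r subr0.
  split=> [c y z [a Ma _] [b Mb _]|[c Mc _]].
    exists (c * a + b) => //.
    rewrite scalerDl -scalerA opprD addrACA -scalerBr; exact: Mlin.
  have [c0|c0] := eqVneq c 0; first by rewrite c0 scale0r subr0 in Mc.
  apply: nx; exists c^-1.
  have := MZ (- c^-1) _ Mc.
  by rewrite scalerBr scalerA mulNr mulVf // !scaleNr scale1r opprK addrC.
have Minj x (c c' : k) : M (x - c *: v) -> M (x - c' *: v) -> c = c'.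
  move=> H H'; apply/eqP; rewrite -subr_eq0; apply/negPn/negP => cc'.
  have : M ((c - c') *: v).
    have -> : (c - c') *: v = -1 *: (x - c *: v) + (x - c' *: v).
      by rewrite scaleN1r opprB addrA subrK scalerBl.
    exact: Mlin.
  by move=> /(MZ (c - c')^-1); rewrite scalerA mulVf // scale1r.
have [phi phiP] := choice Mdec.
exists phi => [c x y|].
  apply: (Minj (c *: x + y)) => //; rewrite scalerDl -scalerA opprD addrACA -scalerBr.
  exact: Mlin.
by apply: (Minj v) => //; rewrite scale1r subrr.
Qed.

Lemma pure_neq0 (k : fieldType) (V W : lmodType k) (v : V) (w : W) :
  v != 0 -> w != 0 -> v ⊗ w != 0.
Proof.
move=> v0 /negP w0; apply/eqP => vw0; apply: w0; apply/eqP.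
have [phi phiL phi1] := ex_linear_form v0.
have fb : is_bilinear (fun (x : V) (y : W) => (phi x : k) *: y).
  split=> [y c x x'|x c y y'] /=; first by rewrite phiL scalerDl scalerA.
  by rewrite scalerDr !scalerA mulrC.
have := tlift_pure v w fb; rewrite vw0 phi1 scale1r => <-.
have L := tlift_is_linear fb.
by have := scalable_linear L => /(_ 0 0); rewrite /= !scale0r.
Qed.

(* A grading V = ⊕_n V_n over int, given by its projections gcomp n : V -> V_n. *)
HB.mixin Record isGraded (k : fieldType) V of GRing.Lmodule k V := {
  gcomp : int -> V -> V;
  gcomp_is_linear : forall n, linear (gcomp n);
  gcompK : forall i j v, gcomp i (gcomp j v) = if i == j then gcomp j v else 0;
  gcomp_fin : forall v, exists s : seq int, uniq s && (v == \sum_(n <- s) gcomp n v)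
}.

#[short(type="gLmodType")]
HB.structure Definition GradedLmodule (k : fieldType) :=
  {V of isGraded k V & GRing.Lmodule k V}.

Definition homog (k : fieldType) (V : gLmodType k) (n : int) (v : V) : Prop :=
  gcomp n v = v.

Definition deg0 (k : fieldType) (V W : gLmodType k) (f : V -> W) : Prop :=
  forall n v, homog n v -> homog n (f v).

Lemma sum_uniq_sub (U : nmodType) (s t : seq int) (F : int -> U) :
  uniq s -> uniq t -> {subset s <= t} -> (forall n, n \notin s -> F n = 0) ->
  \sum_(n <- s) F n = \sum_(n <- t) F n.
Proof.
move=> us ut st F0; rewrite [RHS](bigID (mem s)) /= [X in _ + X]big1 => [|n /F0 //].
rewrite addr0 -[RHS]big_filter; apply: perm_big; apply: uniq_perm => //; first exact: filter_uniq.
move=> n; rewrite mem_filter /=; apply/idP/andP => [ns|[]//].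
by split=> //; exact: st.
Qed.

Section Graded.
Variables (k : fieldType) (V : gLmodType k).
Implicit Types v w : V.

HB.instance Definition _ n := GRing.isLinear.Build k V V *:%R (gcomp n) (gcomp_is_linear n).

Definition gsupp (v : V) : seq int := xchoose (gcomp_fin v).

Lemma gsupp_uniq v : uniq (gsupp v).
Proof. by case/andP: (xchooseP (gcomp_fin v)). Qed.

Lemma gcomp_sum v : v = \sum_(n <- gsupp v) gcomp n v.
Proof. by case/andP: (xchooseP (gcomp_fin v)) => _ /eqP. Qed.

Lemma gcomp0_notin (s : seq int) (v : V) n :
  uniq s -> v = \sum_(i <- s) gcomp i v -> n \notin s -> gcomp n v = 0.
Proof.
move=> us -> ns; rewrite linear_sum big1_seq // => i /andP[_ si].
by rewrite /= gcompK; case: eqP => // ni; rewrite ni si in ns.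
Qed.

Lemma gcomp0 v n : n \notin gsupp v -> gcomp n v = 0.
Proof. exact: gcomp0_notin (gsupp_uniq v) (gcomp_sum v). Qed.

Lemma homog_gcomp n v : homog n (gcomp n v).
Proof. by rewrite /homog gcompK eqxx. Qed.

Lemma homog0 n : homog n (0 : V).
Proof. exact: linear0. Qed.

Lemma homogD n (v w : V) : homog n v -> homog n w -> homog n (v + w).
Proof. by rewrite /homog linearD /= => -> ->. Qed.

Lemma homogZ n c (v : V) : homog n v -> homog n (c *: v).
Proof. by rewrite /homog linearZ /= => ->. Qed.

Lemma gcomp_homog i j (v : V) : homog j v -> gcomp i v = if i == j then v else 0.
Proof. by move=> hv; rewrite -hv gcompK. Qed.

Lemma homog_ind (P : V -> Prop) :
  (forall n v, homog n v -> P v) -> (forall x y, P x -> P y -> P (x + y)) ->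
  forall v, P v.
Proof.
move=> Ph Pa v; rewrite [v]gcomp_sum; elim: (gsupp v) => [|n s IH].
  by rewrite big_nil; apply: (Ph 0); exact: homog0.
by rewrite big_cons; apply: Pa => //; apply: Ph (homog_gcomp n v).
Qed.

(* The linear map equal to F n on V_n.                                        *)
Definition glift (U : lmodType k) (F : int -> V -> U) (v : V) : U :=
  \sum_(n <- gsupp v) F n (gcomp n v).

Lemma glift_sum (U : lmodType k) (F : int -> V -> U) (s : seq int) v :
  (forall n, F n 0 = 0) -> uniq s -> {subset gsupp v <= s} ->
  glift F v = \sum_(n <- s) F n (gcomp n v).
Proof.
move=> F0 us sub; apply: sum_uniq_sub => //; first exact: gsupp_uniq.
by move=> n /gcomp0 ->.
Qed.

Lemma glift_is_linear (U : lmodType k) (F : int -> V -> U) :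
  (forall n, linear (F n)) -> linear (glift F).
Proof.
move=> Fl c v w.
have F0 n : F n 0 = 0 by have := scalable_linear (Fl n) => /(_ 0 0) /=; rewrite !scale0r.
pose s := undup (gsupp v ++ gsupp w ++ gsupp (c *: v + w)).
rewrite !(@glift_sum _ _ s) ?undup_uniq //;
  do ?by move=> n ns; rewrite mem_undup !mem_cat ns ?orbT.
rewrite scaler_sumr -big_split; apply: eq_bigr => n _ /=.
by rewrite linearP Fl.
Qed.

Lemma glift_homog (U : lmodType k) (F : int -> V -> U) n v :
  (forall i, F i 0 = 0) -> homog n v -> glift F v = F n v.
Proof.
move=> F0 hv; rewrite (@glift_sum _ _ (undup (n :: gsupp v))) ?undup_uniq //; last first.
  by move=> i si; rewrite mem_undup inE si orbT.
have nin : n \in undup (n :: gsupp v) by rewrite mem_undup mem_head.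
rewrite (bigD1_seq n) ?undup_uniq //= (gcomp_homog _ hv) eqxx big1 ?addr0 // => i /negbTE ni.
by rewrite (gcomp_homog _ hv) ni.
Qed.

Lemma glift_linear_arg (W U : lmodType k) (F : int -> V -> W -> U) v :
  (forall n v', linear (F n v')) -> linear (fun x : W => glift (fun n v' => F n v' x) v).
Proof.
move=> Fl c w w'; rewrite /glift scaler_sumr -big_split.
by apply: eq_bigr => n _ /=; rewrite Fl.
Qed.

End Graded.

Section GradedTensor.
Variables (k : fieldType) (V W : gLmodType k).

Lemma tensor_homog_ind (P : V ⊗ W -> Prop) :
  (forall i j v w, homog i v -> homog j w -> P (v ⊗ w)) ->
  (forall x y, P x -> P y -> P (x + y)) -> forall x, P x.
Proof.
move=> Ph Pa; elim/tensor_ind => [v w|x y]; last exact: Pa.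
elim/homog_ind: v => [i v hv|v v' Hv Hv']; last by rewrite pureDl; exact: Pa.
elim/homog_ind: w => [j w hw|w w' Hw Hw']; last by rewrite pureDr; exact: Pa.
exact: Ph hv hw.
Qed.

(* (V ⊗ W)_n = ⊕_i V_i ⊗ W_(n-i).                                             *)
Definition tgcomp (n : int) : V ⊗ W -> V ⊗ W :=
  tlift (fun v w => glift (fun i v' => v' ⊗ gcomp (n - i) w) v).

Fact tgcomp_bilinear n :
  is_bilinear (fun (v : V) (w : W) => glift (fun i v' => v' ⊗ gcomp (n - i) w) v).
Proof.
split=> [w|v]; first by apply: glift_is_linear => i c x y; rewrite pureDl pureZl.
by apply: glift_linear_arg => i v' c x y; rewrite linearP pureDr pureZr.
Qed.

HB.instance Definition _ n :=
  GRing.isLinear.Build k _ _ *:%R (tgcomp n) (tlift_is_linear (tgcomp_bilinear n)).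

Fact tgcompE n i j (v : V) (w : W) : homog i v -> homog j w ->
  tgcomp n (v ⊗ w) = if n == i + j then v ⊗ w else 0.
Proof.
move=> hv hw; rewrite /tgcomp (tlift_pure _ _ (tgcomp_bilinear n)) (glift_homog _ hv).
  by rewrite (gcomp_homog _ hw) subr_eq addrC; case: eqP; rewrite ?pure0r.
by move=> m; rewrite pure0l.
Qed.

Fact tgcompK i j x : tgcomp i (tgcomp j x) = if i == j then tgcomp j x else 0.
Proof.
elim/tensor_homog_ind: x => [a b v w hv hw|x y Hx Hy].
  rewrite (tgcompE j hv hw); case: (altP (j =P _)) => [->|nj].
    by rewrite (tgcompE i hv hw); case: ifP.
  by rewrite linear0; case: ifP.
by rewrite !linearD /= Hx Hy; case: ifP; rewrite ?addr0.
Qed.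

Fact tgcomp_fin x : exists s : seq int, uniq s && (x == \sum_(n <- s) tgcomp n x).
Proof.
have D (s : seq int) y n : uniq s -> y = \sum_(i <- s) tgcomp i y ->
    n \notin s -> tgcomp n y = 0.
  move=> us -> ns; rewrite linear_sum big1_seq // => i /andP[_ si].
  by rewrite /= tgcompK; case: eqP => // ni; rewrite ni si in ns.
elim/tensor_homog_ind: x => [a b v w hv hw|x y [s /andP[us /eqP xE]] [t /andP[ut /eqP yE]]].
  by exists [:: a + b]; rewrite big_seq1 (tgcompE _ hv hw) !eqxx.
exists (undup (s ++ t)); rewrite undup_uniq /=; apply/eqP.
under eq_bigr do rewrite linearD /=.
rewrite big_split /= [in LHS]xE [in LHS]yE; congr (_ + _).
- apply: sum_uniq_sub; rewrite ?undup_uniq // => n ns; last exact: (D s).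
  by rewrite mem_undup mem_cat ns.
- apply: sum_uniq_sub; rewrite ?undup_uniq // => n ns; last exact: (D t).
  by rewrite mem_undup mem_cat ns orbT.
Qed.

HB.instance Definition _ := isGraded.Build k (tensor V W)
  (fun n => linearP (tgcomp n)) tgcompK tgcomp_fin.

Lemma homog_pure i j (v : V) (w : W) : homog i v -> homog j w -> homog (i + j) (v ⊗ w).
Proof. by move=> hv hw; have := tgcompE (i + j) hv hw; rewrite eqxx. Qed.

End GradedTensor.

Definition ksign (k : fieldType) (n : int) : k := (-1) ^ n.
Arguments ksign {k} n.

(* The Koszul twist T(v ⊗ w) = (-1)^(|v||w|) w ⊗ v.                           *)
Section Twist.
Variables (k : fieldType) (V W : gLmodType k).
Implicit Types (v : V) (w : W).

Definition twist_fun (v : V) (w : W) : W ⊗ V :=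
  glift (fun i v' => glift (fun j w' => ksign (i * j) *: (w' ⊗ v')) w) v.

Definition twist : V ⊗ W -> W ⊗ V := tlift twist_fun.

Fact twist_bilinear : is_bilinear twist_fun.
Proof.
split=> [w|v].
  apply: glift_is_linear => i; apply: glift_linear_arg => j w' c x y.
  by rewrite pureDr pureZr scalerDr !scalerA mulrC.
apply: glift_linear_arg => i v'; apply: glift_is_linear => j c x y.
by rewrite pureDl pureZl scalerDr !scalerA mulrC.
Qed.

HB.instance Definition _ :=
  GRing.isLinear.Build k _ _ *:%R twist (tlift_is_linear twist_bilinear).

Lemma twistE i j v w : homog i v -> homog j w -> twist (v ⊗ w) = ksign (i * j) *: (w ⊗ v).
Proof.
move=> hv hw; rewrite /twist (tlift_pure _ _ twist_bilinear) /twist_fun (glift_homog _ hv).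
  by rewrite (glift_homog _ hw) // => n; rewrite pure0l scaler0.
by move=> n; rewrite /glift big1 // => m _; rewrite pure0r scaler0.
Qed.

End Twist.

(* (a ⊗ b) ⊗ (a' ⊗ b') |-> (-1)^(|b||a'|) (a ⊗ a') ⊗ (b ⊗ b').                *)
Section Swap.
Variables (k : fieldType) (A B A' B' : gLmodType k).

Definition tswap : (A ⊗ B) ⊗ (A' ⊗ B') -> (A ⊗ A') ⊗ (B ⊗ B') :=
  (@tassocV k A A' (B ⊗ B')%type)
  \o tmap idfun (@tassoc k A' B B' \o tmap (@twist k B A') idfun \o @tassocV k B A' B')
  \o @tassoc k A B (A' ⊗ B')%type.

HB.instance Definition _ := GRing.Linear.on tswap.

Lemma tswapE i j a b a' b' : homog i b -> homog j a' ->
  tswap ((a ⊗ b) ⊗ (a' ⊗ b')) = ksign (i * j) *: ((a ⊗ a') ⊗ (b ⊗ b')).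
Proof.
move=> hb ha; rewrite /tswap /= tassocE tmapE /= tassocVE tmapE /= (twistE hb ha).
by rewrite pureZl linearZ /= tassocE pureZr linearZ /= tassocVE.
Qed.

End Swap.

Section HomogTensor.
Variables (k : fieldType) (V W : gLmodType k).

Lemma homog_tensor_ind (P : int -> V ⊗ W -> Prop) :
  (forall i j v w, homog i v -> homog j w -> P (i + j) (v ⊗ w)) ->
  (forall n x y, P n x -> P n y -> P n (x + y)) ->
  forall n x, homog n x -> P n x.
Proof.
move=> Pp Pa n x <-; elim/tensor_homog_ind: x => [i j v w hv hw|x y].
  rewrite (gcomp_homog _ (homog_pure hv hw)); case: eqP => [->|_]; first exact: Pp.
  have := Pp n 0 0 0 (homog0 V n) (homog0 W 0).
  by rewrite addr0 pure0l.
by rewrite linearD /=; exact: Pa.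
Qed.

End HomogTensor.

Section KSign.
Variable k : fieldType.

Lemma ksignD m n : ksign (m + n) = ksign m * ksign n :> k.
Proof. by rewrite /ksign expfzDr // oppr_eq0 oner_eq0. Qed.

Lemma ksign0 : ksign 0 = 1 :> k.
Proof. by rewrite /ksign expr0z. Qed.

Lemma ksign1 : ksign 1 = -1 :> k.
Proof. by rewrite /ksign expr1z. Qed.

Lemma ksignK n : ksign n * ksign n = 1 :> k.
Proof.
by rewrite -[LHS]expr2 exprnP /ksign exprz_exp mulrC -exprz_exp -exprnP sqrrN expr1n exp1rz.
Qed.

End KSign.

(* The grading of the ground field is concentrated in degree 0.               *)
Section GroundField.
Variable k : fieldType.

Definition kgcomp (n : int) (c : k^o) : k^o := if n == 0 then c else 0.

Fact kgcomp_is_linear n : linear (kgcomp n).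
Proof. by move=> c x y; rewrite /kgcomp; case: eqP => // _; rewrite scaler0 addr0. Qed.

Fact kgcompK i j c : kgcomp i (kgcomp j c) = if i == j then kgcomp j c else 0.
Proof.
rewrite /kgcomp; case: (eqVneq i j) => [->|ij]; first by case: eqP.
by case: eqP => // i0; case: eqP => // j0; rewrite i0 j0 eqxx in ij.
Qed.

Fact kgcomp_fin c : exists s : seq int, uniq s && (c == \sum_(n <- s) kgcomp n c).
Proof. by exists [:: 0]; rewrite big_seq1 /kgcomp !eqxx. Qed.

HB.instance Definition _ := isGraded.Build k k^o kgcomp_is_linear kgcompK kgcomp_fin.

Lemma homog_ground n (c : k^o) : homog n c <-> (n = 0) \/ c = 0.
Proof.
rewrite /homog; have -> : gcomp n c = kgcomp n c by [].
rewrite /kgcomp; case: eqP => [->|n0]; split=> //; first by left.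
  by move=> <-; right.
by case.
Qed.

End GroundField.

HB.mixin Record isGradedAlg (k : fieldType) A
    of GradedLmodule k A & GRing.Algebra k A := {
  homog1 : homog 0 (1 : A);
  homogM : forall i j (x y : A), homog i x -> homog j y -> homog (i + j) (x * y)
}.

#[short(type="gAlgType")]
HB.structure Definition GradedAlg (k : fieldType) :=
  {A of isGradedAlg k A & GradedLmodule k A & GRing.Algebra k A}.
Arguments homog1 {k} s.
Arguments homogM {k s i j x y}.

HB.mixin Record hasDifferential (k : fieldType) V of GradedLmodule k V := {
  dgd : V -> V;
  dgd_is_linear : linear dgd;
  homog_dgd : forall n v, homog n v -> homog (n + 1) (dgd v);
  dgdK : forall v, dgd (dgd v) = 0
}.

#[short(type="dgLmodType")]
HB.structure Definition DGLmodule (k : fieldType) :=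
  {V of hasDifferential k V & GradedLmodule k V}.
Arguments homog_dgd {k s n v}.

HB.instance Definition _ (k : fieldType) (V : dgLmodType k) :=
  GRing.isLinear.Build k V V *:%R dgd dgd_is_linear.

HB.mixin Record isDGAlg (k : fieldType) A of GradedAlg k A & DGLmodule k A := {
  dgdM : forall n (x y : A), homog n x ->
    dgd (x * y) = dgd x * y + ksign n *: (x * dgd y)
}.

#[short(type="dgAlgType")]
HB.structure Definition DGAlg (k : fieldType) :=
  {A of isDGAlg k A & GradedAlg k A & DGLmodule k A}.
Arguments dgdM {k s n x} y.

Section GroundFieldDG.
Variable k : fieldType.

Fact khomog1 : homog 0 (1 : k^o).
Proof. by apply/homog_ground; left. Qed.
Fact khomogM i j (x y : k^o) : homog i x -> homog j y -> homog (i + j) (x * y).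
Proof.
move=> /homog_ground hx /homog_ground hy; apply/homog_ground.
case: hx hy => [-> [->|->]|-> _]; first by left.
- by right; rewrite mulr0.
- by right; rewrite mul0r.
Qed.
HB.instance Definition _ := isGradedAlg.Build k k^o khomog1 khomogM.

Definition kdgd (c : k^o) : k^o := 0.
Fact kdgd_is_linear : linear kdgd.
Proof. by move=> c x y; rewrite /kdgd scaler0 addr0. Qed.
Fact khomog_dgd n c : homog n c -> homog (n + 1) (kdgd c).
Proof. by move=> _; exact: homog0. Qed.
Fact kdgdK c : kdgd (kdgd c) = 0. Proof. by []. Qed.
HB.instance Definition _ := hasDifferential.Build k k^o kdgd_is_linear khomog_dgd kdgdK.

Fact kdgdM n (x y : k^o) : homog n x ->
  dgd (x * y) = dgd x * y + ksign n *: (x * dgd y).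
Proof.
have E (z : k^o) : dgd z = 0 by [].
by move=> _; rewrite !E mul0r mulr0 scaler0 addr0.
Qed.
HB.instance Definition _ := isDGAlg.Build k k^o kdgdM.

End GroundFieldDG.

Section Mult.
Variables (k : fieldType) (A : gAlgType k).

Definition mult : A ⊗ A -> A := tlift *%R.
Fact mult_bilinear : is_bilinear ( *%R : A -> A -> A).
Proof.
by split=> [y|x] c a b /=; rewrite ?mulrDl ?mulrDr -?scalerAl -?scalerAr.
Qed.
HB.instance Definition _ := GRing.isLinear.Build k _ _ *:%R mult (tlift_is_linear mult_bilinear).
Lemma multE a b : mult (a ⊗ b) = a * b.
Proof. exact: tlift_pure mult_bilinear. Qed.

End Mult.

(* The graded algebra A ⊗ B, with (a ⊗ b)(a' ⊗ b') = (-1)^(|a'||b|) aa' ⊗ bb'. *)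
Section TensorAlg.
Variables (k : fieldType) (A B : gAlgType k).
Local Notation AB := (tensor A B).

Definition tmul (x y : AB) : AB := tmap (@mult k A) (@mult k B) (tswap (x ⊗ y)).

Lemma tmulE i j (a a' : A) (b b' : B) : homog i b -> homog j a' ->
  tmul (a ⊗ b) (a' ⊗ b') = ksign (i * j) *: ((a * a') ⊗ (b * b')).
Proof. by move=> hb ha; rewrite /tmul (tswapE _ _ hb ha) linearZ /= tmapE /= !multE. Qed.

Fact tmulDl : left_distributive tmul +%R.
Proof. by move=> x y z; rewrite /tmul pureDl !linearD. Qed.
Fact tmulDr : right_distributive tmul +%R.
Proof. by move=> x y z; rewrite /tmul pureDr !linearD. Qed.
Fact tmulZl c x y : c *: tmul x y = tmul (c *: x) y.
Proof. by rewrite /tmul pureZl !linearZ. Qed.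
Fact tmulZr c x y : c *: tmul x y = tmul x (c *: y).
Proof. by rewrite /tmul pureZr !linearZ. Qed.

Fact tmulA : associative tmul.
Proof.
move=> x y z; elim/tensor_homog_ind: x => [i j a b ha hb|x x']; last by rewrite !tmulDl => -> ->.
elim/tensor_homog_ind: y => [i' j' a' b' ha' hb'|y y']; last first.
  by rewrite !(tmulDl, tmulDr) => -> ->.
elim/tensor_homog_ind: z => [i'' j'' a'' b'' ha'' hb''|z z']; last first.
  by rewrite !(tmulDl, tmulDr) => -> ->.
rewrite (tmulE _ _ hb ha') (tmulE _ _ hb' ha'') -tmulZl -tmulZr.
rewrite (tmulE _ _ hb (homogM ha' ha'')) (tmulE _ _ (homogM hb hb') ha'').
by rewrite !scalerA -!ksignD !mulrA; congr (ksign _ *: _); rewrite mulrDr mulrDl addrC -addrA.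
Qed.

Fact tmul1 : left_id (1 ⊗ 1) tmul.
Proof.
elim/tensor_homog_ind => [i j a b ha hb|x y Hx Hy]; last by rewrite tmulDr Hx Hy.
by rewrite (tmulE _ _ (homog1 _) ha) mul0r ksign0 scale1r !mul1r.
Qed.
Fact tmulr1 : right_id (1 ⊗ 1) tmul.
Proof.
elim/tensor_homog_ind => [i j a b ha hb|x y Hx Hy]; last by rewrite tmulDl Hx Hy.
by rewrite (tmulE _ _ hb (homog1 _)) mulr0 ksign0 scale1r !mulr1.
Qed.

HB.instance Definition _ :=
  GRing.Zmodule_isNzRing.Build AB tmulA tmul1 tmulr1 tmulDl tmulDr
    (pure_neq0 (oner_neq0 A) (oner_neq0 B)).
HB.instance Definition _ := GRing.Lmodule_isLalgebra.Build k AB tmulZl.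
HB.instance Definition _ := GRing.Lalgebra_isAlgebra.Build k AB tmulZr.

Fact thomog1 : homog 0 (1 : AB).
Proof. exact: homog_pure (homog1 A) (homog1 B). Qed.

Fact thomogM i j (x y : AB) : homog i x -> homog j y -> homog (i + j) (x * y).
Proof.
move=> hx; move: i x hx; apply: homog_tensor_ind => [p q a b ha hb|n x x' Hx Hx' hy]; last first.
  by rewrite mulrDl; apply: homogD; [exact: Hx|exact: Hx'].
move: j y; apply: homog_tensor_ind => [p' q' a' b' ha' hb'|n x x' Hx Hx']; last first.
  by rewrite mulrDr; exact: homogD.
rewrite [_ * _](tmulE _ _ hb ha') addrACA; apply: homogZ.
by apply: homog_pure; exact: homogM.
Qed.

HB.instance Definition _ := isGradedAlg.Build k AB thomog1 thomogM.

Lemma tensor_mulE i j (a a' : A) (b b' : B) : homog i b -> homog j a' ->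
  (a ⊗ b) * (a' ⊗ b') = ksign (i * j) *: ((a * a') ⊗ (b * b')).
Proof. exact: tmulE. Qed.

Lemma tensor_oneE : 1 = 1 ⊗ 1 :> A ⊗ B.
Proof. by []. Qed.

End TensorAlg.

(* d(v ⊗ w) = dv ⊗ w + (-1)^|v| v ⊗ dw                                        *)
Section TensorDG.
Variables (k : fieldType) (V W : dgLmodType k).

Definition tdgd_fun (v : V) (w : W) : V ⊗ W :=
  dgd v ⊗ w + glift (fun n v' => ksign n *: (v' ⊗ dgd w)) v.
Definition tdgd : V ⊗ W -> V ⊗ W := tlift tdgd_fun.

Fact tdgd_bilinear : is_bilinear tdgd_fun.
Proof.
have L (w : W) : linear (glift (fun n (v' : V) => ksign n *: (v' ⊗ dgd w))).
  apply: glift_is_linear => n c x y.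
  by rewrite pureDl pureZl scalerDr !scalerA mulrC.
split=> [w|v] c x y; rewrite /tdgd_fun /=.
  by rewrite linearP pureDl pureZl L scalerDr addrACA.
rewrite pureDr pureZr scalerDr addrACA; congr (_ + _).
apply: (@glift_linear_arg _ _ _ _ (fun n v' w => ksign n *: (v' ⊗ dgd w))) => n v' a u w.
by rewrite linearP pureDr pureZr scalerDr !scalerA mulrC.
Qed.

Fact tdgd_is_linear : linear tdgd.
Proof. exact: tlift_is_linear tdgd_bilinear. Qed.

Fact tdgdE n v w : homog n v -> tdgd (v ⊗ w) = dgd v ⊗ w + ksign n *: (v ⊗ dgd w).
Proof.
move=> hv; rewrite /tdgd (tlift_pure _ _ tdgd_bilinear) /tdgd_fun (glift_homog _ hv) //.
by move=> i; rewrite pure0l scaler0.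
Qed.

HB.instance Definition _ := GRing.isLinear.Build k _ _ *:%R tdgd tdgd_is_linear.

Fact thomog_dgd n x : homog n x -> homog (n + 1) (tdgd x).
Proof.
move: n x; apply: homog_tensor_ind => [i j v w hv hw|n x y Hx Hy]; last first.
  by rewrite linearD; exact: homogD.
rewrite (tdgdE _ hv); apply: homogD.
  by rewrite addrAC; apply: homog_pure => //; exact: homog_dgd.
by rewrite -addrA; apply/homogZ/homog_pure => //; exact: homog_dgd.
Qed.

Fact tdgdK x : tdgd (tdgd x) = 0.
Proof.
elim/tensor_homog_ind: x => [i j v w hv hw|x y Hx Hy]; last by rewrite !linearD /= Hx Hy addr0.
rewrite (tdgdE _ hv) linearD linearZ /= (tdgdE _ hv) (tdgdE _ (homog_dgd hv)).
by rewrite !dgdK pure0l pure0r add0r scaler0 addr0 ksignD ksign1 mulrN1 scaleNr addNr.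
Qed.

HB.instance Definition _ :=
  hasDifferential.Build k (tensor V W) tdgd_is_linear thomog_dgd tdgdK.

Lemma tensor_dgdE n v w : homog n v -> dgd (v ⊗ w) = dgd v ⊗ w + ksign n *: (v ⊗ dgd w).
Proof. exact: tdgdE. Qed.

End TensorDG.

Section TensorDGAlg.
Variables (k : fieldType) (A B : dgAlgType k).

Fact tdgdM n (x y : tensor A B) : homog n x ->
  dgd (x * y) = dgd x * y + ksign n *: (x * dgd y).
Proof.
move: n x; apply: homog_tensor_ind => [i j a b ha hb|n x x' Hx Hx']; last first.
  by rewrite linearD /= !mulrDl linearD /= Hx Hx' scalerDr addrACA.
elim/tensor_homog_ind: y => [p q a' b' ha' hb'|y y' Hy Hy']; last first.
  by rewrite linearD /= !mulrDr linearD /= Hy Hy' scalerDr addrACA.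
rewrite (tensor_mulE _ _ hb ha') linearZ /= (tensor_dgdE _ (homogM ha ha')).
rewrite (tensor_dgdE _ ha) (tensor_dgdE _ ha') mulrDl mulrDr -scalerAl -scalerAr.
rewrite !(tensor_mulE _ _ hb ha') (tensor_mulE _ _ (homog_dgd hb) ha').
rewrite (tensor_mulE _ _ hb (homog_dgd ha')) (dgdM _ ha) (dgdM _ hb).
rewrite pureDl pureDr !pureZl !pureZr !scalerDr !scalerA -!addrA.
have E1 : ksign (j * p) * ksign i = ksign (i + j) * ksign (j * (p + 1)) :> k.
  rewrite mulrDr mulr1 !ksignD -!mulrA [ksign j * _]mulrCA [ksign j * ksign j]ksignK.
  by rewrite mulr1 mulrC.
have E2 : ksign (j * p) * ksign (i + p) = ksign i * ksign ((j + 1) * p) :> k.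
  by rewrite mulrDl mul1r !ksignD mulrCA.
have E3 : ksign (j * p) * ksign (i + p) * ksign j = ksign (i + j) * ksign p * ksign (j * p) :> k.
  rewrite !ksignD -!mulrA mulrCA; congr (_ * _).
  by rewrite mulrCA mulrC -!mulrA [ksign (j * p) * _]mulrC -!mulrA; congr (_ * _); rewrite mulrC.
rewrite E3 E1 E2; congr (_ + _).
by rewrite addrCA.
Qed.

HB.instance Definition _ := isDGAlg.Build k (tensor A B) tdgdM.

End TensorDGAlg.

(* The graded opposite algebra: same graded space and differential, with      *)
(* a o b = (-1)^(|a||b|) ba.                                                  *)
Definition gop (A : Type) : Type := A.

HB.instance Definition _ (k : fieldType) (A : gLmodType k) :=
  GradedLmodule.copy (gop A) A.

Section Opposite.
Variables (k : fieldType) (A : gAlgType k).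

Definition opmul (a b : gop A) : gop A := @mult k A (twist ((a : A) ⊗ (b : A))).

Fact opmul_homog i j (a b : A) : homog i a -> homog j b ->
  opmul a b = ksign (i * j) *: (b * a).
Proof. by move=> ha hb; rewrite /opmul (twistE ha hb) linearZ /= multE. Qed.

Fact opmulDl : left_distributive opmul +%R.
Proof. by move=> x y z; rewrite /opmul pureDl !linearD. Qed.
Fact opmulDr : right_distributive opmul +%R.
Proof. by move=> x y z; rewrite /opmul pureDr !linearD. Qed.
Fact opmulZl (c : k) (x y : gop A) : c *: opmul x y = opmul (c *: x) y.
Proof. by rewrite /opmul pureZl !linearZ. Qed.
Fact opmulZr (c : k) (x y : gop A) : c *: opmul x y = opmul x (c *: y).
Proof. by rewrite /opmul pureZr !linearZ. Qed.

Fact opmulA : associative opmul.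
Proof.
move=> x y z; elim/homog_ind: x => [i x hx|x x']; last by rewrite !opmulDl => -> ->.
elim/homog_ind: y => [j y hy|y y']; last by rewrite !(opmulDl, opmulDr) => -> ->.
elim/homog_ind: z => [l z hz|z z']; last by rewrite !(opmulDl, opmulDr) => -> ->.
rewrite (opmul_homog hx hy) (opmul_homog hy hz) -opmulZl -opmulZr.
rewrite (opmul_homog hx (homogM hz hy)) (opmul_homog (homogM hy hx) hz).
rewrite !scalerA -!ksignD -mulrA; congr (ksign _ *: _).
by rewrite mulrDr mulrDl addrA addrC.
Qed.

Fact opmul1 : left_id (1 : A) opmul.
Proof.
elim/homog_ind => [n x hx|x y Hx Hy]; last by rewrite opmulDr Hx Hy.
by rewrite (opmul_homog (homog1 A) hx) mul0r ksign0 scale1r mulr1.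
Qed.
Fact opmulr1 : right_id (1 : A) opmul.
Proof.
elim/homog_ind => [n x hx|x y Hx Hy]; last by rewrite opmulDl Hx Hy.
by rewrite (opmul_homog hx (homog1 A)) mulr0 ksign0 scale1r mul1r.
Qed.

HB.instance Definition _ :=
  GRing.Zmodule_isNzRing.Build (gop A) opmulA opmul1 opmulr1 opmulDl opmulDr
    (oner_neq0 A).
HB.instance Definition _ := GRing.Lmodule_isLalgebra.Build k (gop A) opmulZl.
HB.instance Definition _ := GRing.Lalgebra_isAlgebra.Build k (gop A) opmulZr.

Fact op_homogM i j (x y : gop A) : homog i x -> homog j y -> homog (i + j) (x * y).
Proof.
move=> hx hy; rewrite [_ * _](opmul_homog hx hy) addrC.
by apply: homogZ; exact: (homogM (hy : homog j (y : A)) hx).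
Qed.

HB.instance Definition _ :=
  isGradedAlg.Build k (gop A) (homog1 A) op_homogM.

Lemma gop_mulE i j (a b : A) : homog i a -> homog j b ->
  (a : gop A) * (b : gop A) = ksign (i * j) *: (b * a : A).
Proof. exact: opmul_homog. Qed.

End Opposite.

Section OppositeDG.
Variables (k : fieldType) (A : dgAlgType k).

HB.instance Definition _ :=
  hasDifferential.Build k (gop A) (@dgd_is_linear k A) (@homog_dgd k A) (@dgdK k A).

Fact op_dgdM n (x y : gop A) : homog n x ->
  dgd (x * y) = dgd x * y + ksign n *: (x * dgd y).
Proof.
move=> hx; elim/homog_ind: y => [m y hy|y y' Hy Hy']; last first.
  by rewrite linearD /= !mulrDr linearD /= Hy Hy' scalerDr addrACA.
have hx' : homog n (x : A) := hx; have hy' : homog m (y : A) := hy.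
rewrite [in RHS](gop_mulE (homog_dgd hx') hy') [in RHS](gop_mulE hx' (homog_dgd hy')).
rewrite (gop_mulE hx' hy').
transitivity (ksign (n * m) *: dgd ((y : A) * (x : A)));
  first exact: (scalable_linear (@dgd_is_linear k A)).
rewrite (dgdM (x : A) hy') scalerDr !scalerA addrC mulrDl mulrDr mul1r mulr1 !ksignD.
by rewrite mulrCA ksignK mulr1.
Qed.

HB.instance Definition _ := isDGAlg.Build k (gop A) op_dgdM.

End OppositeDG.

Record graded_alg_hom (k : fieldType) (A B : gAlgType k) (f : A -> B) : Prop := {
  alg_hom_linear : linear f;
  alg_hom_deg0 : deg0 f;
  alg_hom1 : f 1 = 1;
  alg_homM : forall a b, f (a * b) = f a * f b
}.

Record dg_alg_hom (k : fieldType) (A B : dgAlgType k) (f : A -> B) : Prop := {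
  dg_alg_hom_graded : graded_alg_hom f;
  dg_alg_homd : forall a, f (dgd a) = dgd (f a)
}.

(* The bracket of a DG Poisson algebra is the value br (a ⊗ b).               *)
Record dg_poisson_algebra (k : fieldType) (A : dgAlgType k)
    (br : {linear tensor A A -> A}) : Prop := {
  br_deg0 : deg0 br;
  br_skew : forall i j (a b : A), homog i a -> homog j b ->
    br (a ⊗ b) = - (ksign (i * j) *: br (b ⊗ a));
  br_jacobi : forall i j l (a b c : A), homog i a -> homog j b -> homog l c ->
    br (a ⊗ br (b ⊗ c)) =
      br (br (a ⊗ b) ⊗ c) + ksign (i * j) *: br (b ⊗ br (a ⊗ c));
  graded_comm : forall i j (a b : A), homog i a -> homog j b ->
    a * b = ksign (i * j) *: (b * a);
  br_leibniz : forall i j l (a b c : A), homog i a -> homog j b -> homog l c ->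
    br (a ⊗ (b * c)) = br (a ⊗ b) * c + ksign (i * j) *: (b * br (a ⊗ c));
  br_dgd : forall i j (a b : A), homog i a -> homog j b ->
    dgd (br (a ⊗ b)) = br (dgd a ⊗ b) + ksign i *: br (a ⊗ dgd b)
}.

(* {a ⊗ a', b ⊗ b'} = (-1)^(|b||a'|) ({a, b} ⊗ a'b' + ab ⊗ {a', b'})          *)
Definition tensor_br (k : fieldType) (A B : gAlgType k)
    (brA : A ⊗ A -> A) (brB : B ⊗ B -> B) (z : (A ⊗ B) ⊗ (A ⊗ B)) : A ⊗ B :=
  tmap brA (@mult k B) (tswap z) + tmap (@mult k A) brB (tswap z).

Lemma tensor_brE (k : fieldType) (A B : gAlgType k)
    (brA : {linear tensor A A -> A}) (brB : {linear tensor B B -> B}) i j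
    (a b : A) (a' b' : B) : homog i b -> homog j a' ->
  tensor_br brA brB ((a ⊗ a') ⊗ (b ⊗ b')) =
    ksign (i * j) *: (brA (a ⊗ b) ⊗ (a' * b') + (a * b) ⊗ brB (a' ⊗ b')).
Proof.
move=> hb ha; rewrite /tensor_br (tswapE _ _ ha hb) mulrC !linearZ /= !tmapE /= !multE.
by rewrite scalerDr.
Qed.

Record graded_bialgebra (k : fieldType) (H : gAlgType k)
    (Delta : {linear H -> tensor H H}) (eps : {linear H -> k^o}) : Prop := {
  coassoc : forall a,
    tassoc (tmap Delta idfun (Delta a)) = tmap idfun Delta (Delta a);
  counitl : forall a, tunitl (tmap eps idfun (Delta a)) = a;
  counitr : forall a, tunitr (tmap idfun eps (Delta a)) = a;
  Delta_alg_hom : graded_alg_hom Delta;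
  eps_alg_hom : graded_alg_hom eps
}.

Record is_antipode (k : fieldType) (H : gAlgType k) (Delta : {linear H -> tensor H H})
    (eps : {linear H -> k^o}) (S : {linear H -> H}) : Prop := {
  antipode_deg0 : deg0 S;
  antipoder : forall a, mult (tmap idfun S (Delta a)) = (eps a : k) *: 1;
  antipodel : forall a, mult (tmap S idfun (Delta a)) = (eps a : k) *: 1
}.

Record dg_bialgebra (k : fieldType) (H : dgAlgType k)
    (Delta : {linear H -> tensor H H}) (eps : {linear H -> k^o}) : Prop := {
  dg_bialgebra_graded : graded_bialgebra Delta eps;
  dg_bialgebra_epsd : forall a, eps (dgd a) = 0;
  dg_bialgebra_coder : forall a,
    Delta (dgd a) =
      tmap dgd idfun (Delta a) + twist (tmap dgd idfun (twist (Delta a)))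
}.

Record dg_hopf_algebra (k : fieldType) (H : dgAlgType k) (Delta : {linear H -> tensor H H})
    (eps : {linear H -> k^o}) (S : {linear H -> H}) : Prop := {
  dg_hopf_bialgebra : dg_bialgebra Delta eps;
  dg_hopf_antipode : is_antipode Delta eps S
}.

Record dg_poisson_hopf_algebra (k : fieldType) (A : dgAlgType k)
    (Delta : {linear A -> tensor A A}) (eps : {linear A -> k^o}) (S : {linear A -> A})
    (br : {linear tensor A A -> A}) : Prop := {
  dgph_poisson : dg_poisson_algebra br;
  dgph_bialgebra : graded_bialgebra Delta eps;
  dgph_Delta_br : forall a b, Delta (br (a ⊗ b)) = tensor_br br br (Delta a ⊗ Delta b);
  dgph_epsd : forall a, eps (dgd a) = 0;
  (* dgd on the right is the differential of A ⊗ A *)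
  dgph_Deltad : forall a, Delta (dgd a) = dgd (Delta a);
  dgph_antipode : is_antipode Delta eps S
}.

(* DG Lie algebra maps into D with the graded commutator.                     *)
Record dg_lie_hom (k : fieldType) (A D : dgAlgType k) (br : {linear tensor A A -> A})
    (g : A -> D) : Prop := {
  lie_hom_linear : linear g;
  lie_hom_deg0 : deg0 g;
  lie_homd : forall a, g (dgd a) = dgd (g a);
  lie_hom_br : forall i j (a b : A), homog i a -> homog j b ->
    g (br (a ⊗ b)) = g a * g b - ksign (i * j) *: (g b * g a)
}.

Record env_pair (k : fieldType) (A D : dgAlgType k) (br : {linear tensor A A -> A})
    (f g : A -> D) : Prop := {
  env_alg_hom : dg_alg_hom f;
  env_lie_hom : dg_lie_hom br g;
  env_br : forall i j (a b : A), homog i a -> homog j b ->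
    f (br (a ⊗ b)) = g a * f b - ksign (i * j) *: (f b * g a);
  env_mul : forall i j (a b : A), homog i a -> homog j b ->
    g (a * b) = f a * g b + ksign (i * j) *: (f b * g a)
}.

(* An algType is nonzero, so D = 0 is not tested; there phi = 0 is the only    *)
(* map, so the property is the same.                                          *)
Record univ_env (k : fieldType) (A : dgAlgType k) (br : {linear tensor A A -> A})
    (Ae : dgAlgType k) (m h : A -> Ae) : Prop := {
  univ_env_pair : env_pair br m h;
  univ_env_lift : forall (D : dgAlgType k) (f g : A -> D), env_pair br f g ->
    exists2 phi : Ae -> D,
      [/\ dg_alg_hom phi, phi \o m =1 f & phi \o h =1 g] &
      forall psi : Ae -> D,
        [/\ dg_alg_hom psi, psi \o m =1 f & psi \o h =1 g] -> psi =1 phi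
}.

(* Main.v *)
Require Import Defs.
From HB Require Import structures.
From mathcomp Require Import all_boot all_order all_algebra.
From mathcomp Require Import boolp ring.

(** Antipode and Poisson bracket. In a graded commutative Hopf algebra the
    antipode [S] is an algebra map and an involution, and it commutes with a
    differential that is a coderivation. When the algebra is moreover Poisson
    Hopf, [S] is an anti-automorphism of the bracket, S{a, b} = - {S a, S b}.
    All four facts are uniqueness of convolution inverses: two linear maps [f]
    and [g] agree once f(a1) t(a2) = g(a1) t(a2) for an algebra endomorphism
    [t], because t(S a3) cancels t(a2) ([conv_cancel]). For maps of two variables,
    such as S(ab) and S{a, b}, the cancellation is made in each variable in turn
    ([conv2_cancel]). The Koszul sign met in the second variable is absorbed by
    choosing for [t] the automorphism a |-> (-1)^(p|a|) a.

    Existence of [Se]. By these properties of [S] the maps m S and h S satisfy the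
    relations of the enveloping algebra inside the opposite algebra, so the
    universal property provides [Se] ([env_pair_op]).

    The antipode axiom. On h(a) the product of [Se] and the identity under
    convolution is m(S a1) h(a2) + h(S a1) m(a2). In the enveloping algebra
    m(x) h(y) + h(x) m(y) = h(xy) + m{x, y}, and h(1) = 0, so this equals
    m{S a1, a2} ([env_antipodel_h]). Hence the vanishing of {S a1, a2} is what
    the left antipode axiom requires on h(A). The right axiom asks that
    {a1, S a2} vanish, which follows by applying [S] to {S a1, a2}
    ([antipode_br_swap]). On m(A) both axioms
    hold because [S] is an antipode, and they pass to products because [Se] reverses
    them: in Se(y1) Se(x1) x2 y2 the inner factor Se(x1) x2 is a scalar
    ([antipodel_mul], [antipoder_mul]).

    Two facts about the enveloping algebra are drawn from its universal
    property by exhibiting suitable DG algebras. It is generated by m(A) and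
    h(A): the subalgebra that they generate is a DG algebra, and the map into it
    composed with the inclusion must be the identity ([univ_env_gen]). And
    [m] is injective: A acts on itself by multiplications and by the
    derivations {a, -}, which is a compatible pair of maps into the DG algebra
    of graded endomorphisms of A, and a = a 1 is recovered from the action
    ([env_mul_inj]). Injectivity turns m{S a1, a2} = 0 into {S a1, a2} = 0. *)

Set Implicit Arguments.
Unset Strict Implicit.
Unset Printing Implicit Defensive.
Import GRing.Theory.
Local Open Scope ring_scope.

(** * Signs and linear maps *)

(** The witness [q], half of the difference of the exponents, leaves an identity
    in a commutative ring as the only obligation. *)
Lemma ksign_eq (k : fieldType) (q m n : int) : m = n + q + q -> ksign m = ksign n :> k.
Proof. by move=> ->; rewrite -addrA ksignD [ksign (q + q)]ksignD ksignK mulr1. Qed.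

HB.instance Definition _ (k : fieldType) (V W : lmodType k) (v : V) :=
  GRing.isLinear.Build k W (tensor V W) *:%R (pure v) ((pure_bilinear V W).2 v).

Definition pure_r (k : fieldType) (V W : lmodType k) (w : W) (v : V) : V ⊗ W := v ⊗ w.
HB.instance Definition _ (k : fieldType) (V W : lmodType k) (w : W) :=
  GRing.isLinear.Build k V (tensor V W) *:%R (pure_r w) ((pure_bilinear V W).1 w).

Section Sigma.
Variables (k : fieldType) (V : gLmodType k) (p : int).

(** The sign produced by moving an element of degree [p] across [v]. *)
Definition sigma : V -> V := glift (fun i v => ksign (p * i) *: v).

Fact sigma_is_linear : linear sigma.
Proof. by apply: glift_is_linear => n c x y; rewrite scalerDr !scalerA mulrC. Qed.
HB.instance Definition _ := GRing.isLinear.Build k V V *:%R sigma sigma_is_linear.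

Lemma sigmaE i v : homog i v -> sigma v = ksign (p * i) *: v.
Proof. by move=> hv; rewrite /sigma (glift_homog _ hv) // => n; rewrite scaler0. Qed.

End Sigma.
Arguments sigma {k V}.

Lemma sigma1 (k : fieldType) (A : gAlgType k) p : sigma p (1 : A) = 1.
Proof. by rewrite (sigmaE _ (homog1 A)) mulr0 ksign0 scale1r. Qed.

Lemma sigmaM (k : fieldType) (A : gAlgType k) p (a b : A) :
  sigma p (a * b) = sigma p a * sigma p b.
Proof.
elim/homog_ind: a => [i a ha|a a' Ha Ha']; last by rewrite mulrDl !linearD /= mulrDl Ha Ha'.
elim/homog_ind: b => [j b hb|b b' Hb Hb']; last by rewrite mulrDr !linearD /= mulrDr Hb Hb'.
rewrite (sigmaE _ ha) (sigmaE _ hb) (sigmaE _ (homogM ha hb)).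
by rewrite -scalerAl -scalerAr scalerA -ksignD mulrDr.
Qed.

Lemma dgd1 (k : fieldType) (A : dgAlgType k) : dgd (1 : A) = 0.
Proof.
have := dgdM 1 (homog1 A); rewrite !mulr1 mul1r ksign0 scale1r.
by move/eqP; rewrite -subr_eq subrr => /eqP.
Qed.

Lemma eq_tmap (k : fieldType) (V V' W W' : lmodType k) (f f' : {linear V -> V'})
  (g g' : {linear W -> W'}) : f =1 f' -> g =1 g' -> tmap f g =1 tmap f' g'.
Proof.
move=> ef eg; elim/tensor_ind => [v w|x y Hx Hy]; last by rewrite !linearD /= Hx Hy.
by rewrite !tmapE ef eg.
Qed.

Lemma tmap_comp (k : fieldType) (V V' V'' W W' W'' : lmodType k)
  (f : {linear V' -> V''}) (f' : {linear V -> V'})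
  (g : {linear W' -> W''}) (g' : {linear W -> W'}) x :
  tmap f g (tmap f' g' x) = tmap (f \o f') (g \o g') x.
Proof.
elim/tensor_ind: x => [v w|x y Hx Hy]; first by rewrite !tmapE.
by rewrite !linearD /= Hx Hy.
Qed.

(** * Convolution *)

Section Conv.
Variables (k : fieldType) (A : gAlgType k).
Variables (Delta : {linear A -> tensor A A}) (eps : {linear A -> k^o}) (S : {linear A -> A}).
Hypotheses (hB : graded_bialgebra Delta eps) (hS : is_antipode Delta eps S).

(** g(a) = g(a1) t(a2) t(S a3), where coassociativity lets the first two factors be
    grouped. *)
Lemma conv_cancel (t : {linear A -> A}) (g : {linear A -> A}) :
  t 1 = 1 -> (forall a b, t (a * b) = t a * t b) ->
  (forall a, mult (tmap g t (Delta a)) = 0) -> forall a, g a = 0.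
Proof.
move=> t1 tM H a.
(* Coassociativity turns L into R; L vanishes by H, and R computes g. *)
pose L z := mult (tmap (@mult k A \o tmap g t) (t \o S) z).
pose R z := mult (tmap g (t \o @mult k A \o tmap idfun S) z).
have LR z : L z = R (tassoc z).
  rewrite /L /R; elim/tensor_ind: z => [x c|z z' Hz Hz']; last by rewrite !linearD /= Hz Hz'.
  elim/tensor_ind: x => [a' b'|x x' Hx Hx']; last by rewrite pureDl !linearD /= Hx Hx'.
  by rewrite tassocE !tmapE /= !tmapE !Defs.multE tM mulrA.
have <- : L (tmap Delta idfun (Delta a)) = 0.
  rewrite /L tmap_comp.
  elim/tensor_ind: (Delta a) => [b c|x x' Hx Hx']; last by rewrite linearD linearD /= Hx Hx' addr0.
  by rewrite tmapE /= Defs.multE H mul0r.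
rewrite LR (coassoc hB) /R tmap_comp -{1}[a](counitr hB).
elim/tensor_ind: (Delta a) => [b c|x x' Hx Hx']; last by rewrite !linearD /= Hx Hx'.
rewrite !tmapE /= Defs.multE tunitrE (antipoder hS).
by rewrite !linearZ /= t1 -scalerAr mulr1.
Qed.

(** The convolution product of two maps on the tensor square, at [x] and [y]:
    on pure tensors (-1)^(|b||c|) f(a, c) g(b, d). *)
Definition conv2 (f g : tensor A A -> A) (x y : tensor A A) : A :=
  mult (tmap f g (tswap (x ⊗ y))).

Lemma conv2E (f g : {linear tensor A A -> A}) i j a b c d :
  homog i b -> homog j c ->
  conv2 f g (a ⊗ b) (c ⊗ d) = ksign (i * j) *: (f (a ⊗ c) * g (b ⊗ d)).
Proof. by move=> hb hc; rewrite /conv2 (tswapE _ _ hb hc) !linearZ /= tmapE Defs.multE. Qed.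

Lemma conv2Dl (f g : {linear tensor A A -> A}) x x' y :
  conv2 f g (x + x') y = conv2 f g x y + conv2 f g x' y.
Proof. by rewrite /conv2 pureDl !linearD. Qed.

Lemma conv2Dr (f g : {linear tensor A A -> A}) x y y' :
  conv2 f g x (y + y') = conv2 f g x y + conv2 f g x y'.
Proof. by rewrite /conv2 pureDr !linearD. Qed.

(** With the first variable fixed as a tensor [x], the convolution is
    H(b1) b2 for H(b) = conv2 f mult x (b, 1), so [conv_cancel] removes [b2].
    What remains, for [b] of degree [p], is f(a1, b) (-1)^(p|a2|) a2, and
    [conv_cancel] for [sigma p] removes [a2]. *)
Lemma conv2_cancel (f : {linear tensor A A -> A}) :
  (forall a b, conv2 f (@mult k A) (Delta a) (Delta b) = 0) -> forall x, f x = 0.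
Proof.
move=> H.
have H1 x b : (forall b, conv2 f (@mult k A) x (Delta b) = 0) ->
    conv2 f (@mult k A) x (b ⊗ 1) = 0.
  move=> Hx.
  pose g := @mult k A \o (tmap f (@mult k A) \o (@tswap k A A A A \o (pure x \o pure_r 1))).
  apply: (@conv_cancel idfun g _ _ _ b) => // b'; rewrite -[RHS](Hx b').
  elim/tensor_homog_ind: (Delta b') => [i j c d hc hd|y y' Hy Hy']; last first.
    by rewrite conv2Dr !linearD /= Hy Hy'.
  rewrite tmapE /= Defs.multE -/(conv2 f (@mult k A) x (c ⊗ 1)).
  elim/tensor_homog_ind: x {H Hx} @g => [i' j' a' b'' ha hb|x x' Hx Hx'] /=; last first.
    by rewrite !conv2Dl mulrDl Hx Hx'.
  by rewrite !(conv2E _ _ _ _ hb hc) /= !Defs.multE mulr1 -scalerAl mulrA.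
have H2 : forall a b, f (a ⊗ b) = 0; last first.
  by elim/tensor_ind => [v w //|x y Hx Hy]; rewrite linearD Hx Hy addr0.
move=> a; elim/homog_ind => [p b hb|b b' Hb Hb']; last by rewrite pureDr linearD Hb Hb' addr0.
apply: (@conv_cancel (sigma p) (f \o pure_r b)); [exact: sigma1|exact: sigmaM|].
move=> a'; rewrite -[RHS](H1 (Delta a') b (H a')).
elim/tensor_homog_ind: (Delta a') => [i j c d hc hd|y y' Hy Hy']; last first.
  by rewrite conv2Dl !linearD /= Hy Hy'.
by rewrite tmapE (conv2E _ _ _ _ hd hb) /= !Defs.multE (sigmaE _ hd) -scalerAr mulr1 [in RHS]mulrC.
Qed.

End Conv.

(** * The antipode of a graded commutative Hopf algebra *)

Section Antipode.
Variables (k : fieldType) (A : gAlgType k).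
Variables (Delta : {linear A -> tensor A A}) (eps : {linear A -> k^o}) (S : {linear A -> A}).
Hypotheses (hB : graded_bialgebra Delta eps) (hS : is_antipode Delta eps S).

Lemma antipode1 : S 1 = 1.
Proof.
have := antipoder hS 1; rewrite (alg_hom1 (Delta_alg_hom hB)) (alg_hom1 (eps_alg_hom hB)).
by rewrite tensor_oneE tmapE Defs.multE mul1r scale1r.
Qed.

(** The counit vanishes outside degree 0, so a Koszul sign next to it is trivial. *)
Lemma eps_sign i j a : homog i a -> ksign (i * j) * (eps a : k) = eps a.
Proof.
move/(alg_hom_deg0 (eps_alg_hom hB))/homog_ground => [->|->]; last by rewrite mulr0.
by rewrite mul0r ksign0 mul1r.
Qed.

Hypothesis comm : forall i j (a b : A), homog i a -> homog j b ->
  a * b = ksign (i * j) *: (b * a).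

(** Both sides are left convolution inverses of the multiplication. *)
Lemma antipodeM a b : S (a * b) = S a * S b.
Proof.
pose f := (S \o @mult k A) \- (@mult k A \o tmap S S).
suff /(_ (a ⊗ b)) : forall x, f x = 0.
  by rewrite /f /= tmapE !Defs.multE => /eqP; rewrite subr_eq0 => /eqP.
apply: (conv2_cancel hB hS) => {}a {}b.
(* The product of the tensor square is itself a convolution. *)
have F1 x y : conv2 (S \o @mult k A) (@mult k A) x y = mult (tmap S idfun (x * y)).
  rewrite [x * y]/(tmap (@mult k A) (@mult k A) (tswap (x ⊗ y))) tmap_comp.
  by rewrite /conv2; congr mult; apply: eq_tmap.
have F2 x y : conv2 (@mult k A \o tmap S S) (@mult k A) x y =
    mult (tmap S idfun x) * mult (tmap S idfun y).
  elim/tensor_homog_ind: x => [i j c d hc hd|x x' Hx Hx']; last first.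
    by rewrite conv2Dl !linearD /= Hx Hx' mulrDl.
  elim/tensor_homog_ind: y => [i' j' c' d' hc' hd'|y y' Hy Hy']; last first.
    by rewrite conv2Dr !linearD /= Hy Hy' mulrDr.
  rewrite (conv2E _ _ _ _ hd hc') /= !tmapE !Defs.multE /= mulrA -[S c * _ * d]mulrA.
  rewrite -[S c * d * _]mulrA [d * (S c' * d')]mulrA (comm hd (antipode_deg0 hS hc')).
  by rewrite -!(scalerAl, scalerAr) !mulrA.
rewrite -[RHS](subrr (((eps a : k) *: (1 : A)) * ((eps b : k) *: 1))).
have -> : conv2 f (@mult k A) (Delta a) (Delta b) =
    conv2 (S \o @mult k A) (@mult k A) (Delta a) (Delta b)
    - conv2 (@mult k A \o tmap S S) (@mult k A) (Delta a) (Delta b).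
  rewrite /conv2; elim/tensor_ind: (tswap _) => [v w|x y Hx Hy].
    by rewrite !tmapE !Defs.multE -mulrBl.
  by rewrite !linearD /= Hx Hy addrACA.
rewrite F1 F2 -(alg_homM (Delta_alg_hom hB)) !(antipodel hS); congr (_ - _).
by rewrite (alg_homM (eps_alg_hom hB)) -scalerAl -scalerAr mulr1 scalerA.
Qed.

(** [S \o S] and the identity are both left convolution inverses of [S]; the
    cancellation uses [S] itself as the algebra endomorphism. *)
Lemma antipodeK a : S (S a) = a.
Proof.
pose f := (S \o S) \- (@idfun A).
suff /eqP : f a = 0 by rewrite subr_eq0 => /eqP.
apply: (conv_cancel hB hS antipode1 antipodeM) => {}a.
have -> : mult (tmap f S (Delta a)) = S (mult (tmap S idfun (Delta a))) -
     mult (tmap idfun S (Delta a)).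
  elim/tensor_ind: (Delta a) => [v w|x y Hx Hy].
    by rewrite !tmapE !Defs.multE antipodeM -mulrBl.
  by rewrite !linearD /= Hx Hy addrACA.
by rewrite (antipoder hS) (antipodel hS) linearZ /= antipode1 subrr.
Qed.

End Antipode.

(** Differentiating S(a1) a2 = eps(a) 1 gives d(S a1) a2 + (+/-) S(a1) d(a2) = 0,
    and the antipode identity at d(a) gives the same with S(d a1) in place of d(S a1). *)
Lemma antipode_dgd (k : fieldType) (A : dgAlgType k) (Delta : {linear A -> tensor A A})
    (eps : {linear A -> k^o}) (S : {linear A -> A}) :
  graded_bialgebra Delta eps -> is_antipode Delta eps S ->
  (forall a, eps (dgd a) = 0) -> (forall a, Delta (dgd a) = dgd (Delta a)) ->
  forall a, S (dgd a) = dgd (S a).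
Proof.
move=> hB hS ed Dd a.
pose f := (@dgd k A \o S) \- (S \o @dgd k A).
suff /eqP : f a = 0 by rewrite subr_eq0 => /eqP.
apply: (conv_cancel hB hS (t := idfun)) => // {}a.
have -> : mult (tmap f idfun (Delta a)) = dgd (mult (tmap S idfun (Delta a))) -
     mult (tmap S idfun (dgd (Delta a))).
  elim/tensor_homog_ind: (Delta a) => [i j v w hv hw|x y Hx Hy].
    rewrite (tensor_dgdE _ hv) !linearD !linearZ /= !tmapE !Defs.multE /=.
    rewrite (dgdM _ (antipode_deg0 hS hv)) mulrBl.
    by rewrite scalerN addrACA subrr addr0.
  by rewrite !linearD /= Hx Hy addrACA.
by rewrite -Dd !(antipodel hS) ed scale0r subr0 linearZ /= dgd1 scaler0.
Qed.

(** * The antipode and the Poisson bracket *)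

Section Poisson.
Variables (k : fieldType) (A : dgAlgType k) (br : {linear tensor A A -> A}).
Hypothesis hP : dg_poisson_algebra br.

Lemma br1 a : br (a ⊗ 1) = 0.
Proof.
elim/homog_ind: a => [i a ha|a b Ha Hb]; last by rewrite pureDl linearD Ha Hb addr0.
have := br_leibniz hP ha (homog1 A) (homog1 A).
rewrite !mulr1 mulr0 ksign0 scale1r mul1r => /eqP.
by rewrite -subr_eq subrr eq_sym => /eqP.
Qed.

Lemma br1l a : br (1 ⊗ a) = 0.
Proof.
elim/homog_ind: a => [i a ha|a b Ha Hb]; last by rewrite pureDr linearD Ha Hb addr0.
by rewrite (br_skew hP (homog1 A) ha) br1 scaler0 oppr0.
Qed.

(** The Leibniz rule in the first argument, from the one in the second by skew
    symmetry. *)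
Lemma br_leibnizl i j l (a b c : A) : homog i a -> homog j b -> homog l c ->
  br ((a * b) ⊗ c) = a * br (b ⊗ c) + ksign (j * l) *: (br (a ⊗ c) * b).
Proof.
move=> ha hb hc; rewrite (br_skew hP (homogM ha hb) hc) (br_leibniz hP hc ha hb).
rewrite (br_skew hP hc ha) (br_skew hP hc hb) mulrN scalerN mulNr !scalerDr !scalerN.
rewrite opprD !opprK -!(scalerAl, scalerAr) !scalerA -!ksignD addrC.
congr (_ + _); last first.
  by congr (_ *: _); apply: (@ksign_eq _ (i * l)); ring.
rewrite (@ksign_eq _ (i * l + j * l) _ 0) ?ksign0 ?scale1r //; ring.
Qed.

End Poisson.

Section PoissonHopf.
Variables (k : fieldType) (A : dgAlgType k).
Variables (Delta : {linear A -> tensor A A}) (eps : {linear A -> k^o}) (S : {linear A -> A}).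
Variable br : {linear tensor A A -> A}.
Hypothesis hA : dg_poisson_hopf_algebra Delta eps S br.
Let hP := dgph_poisson hA.
Let hB := dgph_bialgebra hA.
Let hS := dgph_antipode hA.

(** Applying the counit to both factors of Delta{a, b} = {Delta a, Delta b} yields
    eps{a, b} = 2 eps{a, b}. *)
Lemma eps_br a b : eps (br (a ⊗ b)) = 0.
Proof.
pose D x y := tensor_br br br (x ⊗ y).
have DE x y : D x y = tensor_br br br (x ⊗ y) by [].
have Dl x x' y : D (x + x') y = D x y + D x' y.
  by rewrite /D /tensor_br pureDl !linearD addrACA.
have Dr x y y' : D x (y + y') = D x y + D x y'.
  by rewrite /D /tensor_br pureDr !linearD addrACA.
clearbody D.
(* One summand of the tensor bracket is recovered from the counits of the right
   factors, the other from those of the left factors. *)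
have E x y : eps (tunitl (tmap eps idfun (D x y))) =
    eps (br (tunitr (tmap idfun eps x) ⊗ tunitr (tmap idfun eps y)))
    + eps (br (tunitl (tmap eps idfun x) ⊗ tunitl (tmap eps idfun y))).
  elim/tensor_homog_ind: x => [i j c d hc hd|x x' Hx Hx']; last first.
    by rewrite Dl !linearD /= !pureDl !linearD /= Hx Hx' addrACA.
  elim/tensor_homog_ind: y => [i' j' c' d' hc' hd'|y y' Hy Hy']; last first.
    by rewrite Dr !linearD /= Hy Hy' addrACA.
  rewrite DE (tensor_brE _ _ _ _ hc' hd) !linearZ !linearD /= !tmapE.
  rewrite !(tunitlE, tunitrE) !(pureZl, pureZr) !linearZ /= !(alg_homM (eps_alg_hom hB)).
  rewrite scalerDr; congr (_ + _).
    rewrite [RHS]mulrCA [RHS]mulrC -[in RHS](eps_sign hB i' hd) /=.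
    by rewrite /GRing.scale /= [j * i']mulrC; ring.
  rewrite -[in RHS](eps_sign hB j hc') /=.
  by rewrite /GRing.scale /=; ring.
have := E (Delta a) (Delta b); rewrite DE -(dgph_Delta_br hA) !(counitl hB) !(counitr hB).
by move/eqP; rewrite -subr_eq subrr eq_sym => /eqP.
Qed.

(** Convolved with the multiplication, {S a, S b} gives S(a1 b1) {a2, b2} up to
    terms that contain a bracket with S(b1) b2 or with S(a1) a2, that is,
    with a scalar; these vanish. On the other hand S{a, b} gives eps{a, b} = 0 minus
    S(a1 b1) {a2, b2}, by compatibility of the bracket with the coproduct. *)
Lemma antipode_br a b : S (br (a ⊗ b)) = - br (S a ⊗ S b).
Proof.
pose f := (S \o br) \+ (br \o tmap S S).
suff /(_ (a ⊗ b)) : forall x, f x = 0.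
  by rewrite /f /= tmapE => /eqP; rewrite addr_eq0 => /eqP.
apply: (conv2_cancel hB hS) => {}a {}b.
pose mu := @mult k A.
have F3 x y : mult (tmap S idfun (tensor_br br br (x ⊗ y))) =
    conv2 (S \o br) mu x y + conv2 (S \o mu) br x y.
  by rewrite /tensor_br !linearD /= !tmap_comp.
(* The last two terms are {S x1, z} x2, with z = S(y1) y2, and S(y1) {w, y2},
   with w = S(x1) x2: once expanded by the Leibniz rules, their mixed terms
   S(y1) {S x1, y2} x2 cancel. Pairing z and w with 1 brings in the Koszul
   signs. *)
have F4 x y : conv2 (br \o tmap S S) mu x y =
    conv2 (mu \o tmap S S) br x y
    + (conv2 br mu (tmap S idfun x) (mult (tmap S idfun y) ⊗ 1)
    - conv2 mu br (1 ⊗ mult (tmap S idfun x)) (tmap S idfun y)).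
  elim/tensor_homog_ind: x => [i j c d hc hd|x x' Hx Hx']; last first.
    by rewrite !linearD /= !conv2Dl Hx Hx' opprD [X in _ = _ + X]addrACA [RHS]addrACA.
  elim/tensor_homog_ind: y => [i' j' c' d' hc' hd'|y y' Hy Hy']; last first.
    rewrite !linearD /= pureDl !conv2Dr Hy Hy' opprD.
    by rewrite [X in _ = _ + X]addrACA [RHS]addrACA.
  have hSc := antipode_deg0 hS hc; have hSc' := antipode_deg0 hS hc'.
  rewrite !tmapE !Defs.multE /= (conv2E _ _ _ _ hd hc') (conv2E _ _ _ _ hd hc').
  rewrite (conv2E _ _ _ _ hd (homogM hSc' hd')) (conv2E _ _ _ _ (homogM hSc hd) hSc') /=.
  rewrite !tmapE /= !Defs.multE mulr1 mul1r.
  rewrite (br_leibniz hP hSc hSc' hd') (br_leibnizl hP hSc hd hd').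
  rewrite (graded_comm hP hd hd') (graded_comm hP hSc hSc') !mulrDl !mulrDr.
  rewrite -!(scalerAl, scalerAr) !mulrA !scalerDr !scalerA -!ksignD.
  rewrite [i * i' + j * i']addrC [_ + i * i' + j * j']addrAC.
  by rewrite opprD [_ + _ + (_ + _)]addrACA subrr addr0 addrCA subrr addr0.
have -> : conv2 f mu (Delta a) (Delta b) =
    conv2 (S \o br) mu (Delta a) (Delta b) + conv2 (br \o tmap S S) mu (Delta a) (Delta b).
  rewrite /conv2; elim/tensor_ind: (tswap _) => [v w|x y Hx Hy].
    by rewrite !tmapE !Defs.multE -mulrDl.
  by rewrite !linearD /= Hx Hy addrACA.
have E0 : conv2 (S \o mu) br (Delta a) (Delta b) =
    conv2 (mu \o tmap S S) br (Delta a) (Delta b).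
  congr mult; apply: eq_tmap => // x /=.
  elim/tensor_ind: x => [v w|x y Hx Hy]; last by rewrite !linearD /= Hx Hy.
  by rewrite tmapE !Defs.multE (antipodeM hB hS (graded_comm hP)).
rewrite F4 -E0 addrA -F3 -(dgph_Delta_br hA) !(antipodel hS) eps_br scale0r add0r.
(* The two remaining terms are brackets with a multiple of 1. *)
have V1 c x : conv2 br mu x ((c *: (1 : A)) ⊗ 1) = 0.
  elim/tensor_homog_ind: x => [i j u v hu hv|x y Hx Hy]; last by rewrite conv2Dl Hx Hy addr0.
  rewrite (conv2E _ _ _ _ hv (homogZ c (homog1 A))) /= pureZr linearZ /=.
  by rewrite (br1 hP) scaler0 mul0r scaler0.
have V2 c y : conv2 mu br (1 ⊗ (c *: (1 : A))) y = 0.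
  elim/tensor_homog_ind: y => [i j u v hu hv|x y Hx Hy]; last by rewrite conv2Dr Hx Hy addr0.
  rewrite (conv2E _ _ _ _ (homogZ c (homog1 A)) hu) /= pureZl linearZ /=.
  by rewrite (br1l hP) scaler0 mulr0 scaler0.
by rewrite V1 V2 subr0.
Qed.

(** S{S a1, a2} = - {S (S a1), S a2} = - {a1, S a2}. *)
Lemma antipode_br_swap :
  (forall a, br (tmap S idfun (Delta a)) = 0) ->
  forall a, br (tmap idfun S (Delta a)) = 0.
Proof.
move=> H a; apply/eqP; rewrite -oppr_eq0 -[0](linear0 S) -(H a); apply/eqP.
elim/tensor_ind: (Delta a) => [v w|x y Hx Hy]; last by rewrite !linearD /= Hx Hy.
by rewrite !tmapE antipode_br (antipodeK hB hS (graded_comm hP)).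
Qed.

End PoissonHopf.

(** * DG algebras inside an algebra *)

(** A common framework for two DG algebras built inside an algebra [E]: a
    subalgebra of a DG algebra, and the graded endomorphisms inside all linear
    endomorphisms. In the second case [E] is not graded: the components
    [pr n] sum to the identity only on [Q]. *)
Record dg_closed (k : fieldType) (E : algType k) (pr : int -> E -> E) (D : E -> E)
    (Q : {pred E}) : Prop := {
  dgc_alg : subalg_closed Q;
  dgc_pr_linear : forall n, linear (pr n);
  dgc_pr : forall n x, x \in Q -> pr n x \in Q;
  dgc_prK : forall i j x, pr i (pr j x) = if i == j then pr j x else 0;
  dgc_fin : forall x, x \in Q -> exists s : seq int, uniq s && (x == \sum_(n <- s) pr n x);
  dgc_pr1 : pr 0 1 = 1;
  dgc_prM : forall i j x y, pr i x = x -> pr j y = y -> pr (i + j) (x * y) = x * y;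
  dgc_D_linear : linear D;
  dgc_D : forall x, x \in Q -> D x \in Q;
  dgc_prD : forall n x, pr n x = x -> pr (n + 1) (D x) = D x;
  dgc_DK : forall x, D (D x) = 0;
  dgc_DM : forall n x y, pr n x = x -> D (x * y) = D x * y + ksign n *: (x * D y)
}.

Section DGSub.
Variables (k : fieldType) (E : algType k) (pr : int -> E -> E) (D : E -> E).
Variables (Q : {pred E}) (H : dg_closed pr D Q).

(** The proof of closure is an argument of the type so that the structures
    below can be inferred. *)
Definition dgsub of dg_closed pr D Q := {x : E | x \in Q}.
Local Notation B := (dgsub H).

HB.instance Definition _ := SubChoice.on B.
HB.instance Definition _ :=
  GRing.SubChoice_isSubAlgebra.Build k E _ B (GRing.subalg_closed_semi (dgc_alg H)).

Definition dgsub_gcomp n (x : B) : B := Sub (pr n (val x)) (dgc_pr H n (valP x)).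
Definition dgsub_dgd (x : B) : B := Sub (D (val x)) (dgc_D H (valP x)).

Fact dgsub_gcomp_linear n : linear (dgsub_gcomp n).
Proof. by move=> c x y; apply: val_inj; exact: (dgc_pr_linear H). Qed.

Fact dgsub_gcompK i j x :
  dgsub_gcomp i (dgsub_gcomp j x) = if i == j then dgsub_gcomp j x else 0.
Proof. by apply: val_inj; rewrite !SubK (dgc_prK H); case: eqP. Qed.

Fact dgsub_val_sum (s : seq int) (F : int -> B) :
  val (\sum_(n <- s) F n) = \sum_(n <- s) val (F n).
Proof. exact: (raddf_sum (val : {additive B -> E})). Qed.

Fact dgsub_fin x : exists s : seq int, uniq s && (x == \sum_(n <- s) dgsub_gcomp n x).
Proof.
have [s /andP[us /eqP xE]] := dgc_fin H (valP x).
by exists s; rewrite us; apply/eqP/val_inj; rewrite dgsub_val_sum.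
Qed.

HB.instance Definition _ := isGraded.Build k B dgsub_gcomp_linear dgsub_gcompK dgsub_fin.

Lemma dgsub_homog n (x : B) : homog n x <-> pr n (val x) = val x.
Proof. by split=> [<-|xE]; [rewrite /= (dgc_prK H) eqxx|apply: val_inj]. Qed.

Fact dgsub_homog1 : homog 0 (1 : B).
Proof. exact/dgsub_homog/(dgc_pr1 H). Qed.

Fact dgsub_homogM i j (x y : B) : homog i x -> homog j y -> homog (i + j) (x * y).
Proof. by move=> /dgsub_homog hx /dgsub_homog hy; apply/dgsub_homog/(dgc_prM H). Qed.

HB.instance Definition _ := isGradedAlg.Build k B dgsub_homog1 dgsub_homogM.

Fact dgsub_dgd_linear : linear dgsub_dgd.
Proof. by move=> c x y; apply: val_inj; exact: (dgc_D_linear H). Qed.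

Fact dgsub_homog_dgd n (x : B) : homog n x -> homog (n + 1) (dgsub_dgd x).
Proof. by move=> /dgsub_homog hx; apply/dgsub_homog/(dgc_prD H). Qed.

Fact dgsub_dgdK x : dgsub_dgd (dgsub_dgd x) = 0.
Proof. by apply: val_inj; rewrite !SubK (dgc_DK H). Qed.

HB.instance Definition _ :=
  hasDifferential.Build k B dgsub_dgd_linear dgsub_homog_dgd dgsub_dgdK.

Fact dgsub_dgdM n (x y : B) : homog n x ->
  dgd (x * y) = dgd x * y + ksign n *: (x * dgd y).
Proof. by move=> /dgsub_homog hx; apply: val_inj; exact: (dgc_DM H _ hx). Qed.

HB.instance Definition _ := isDGAlg.Build k B dgsub_dgdM.

End DGSub.

(** * The algebra of linear endomorphisms *)

Record linop (k : fieldType) (V : lmodType k) :=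
  Linop { linop_fun :> V -> V; linop_linear : linear linop_fun }.

Section Linop.
Variables (k : fieldType) (V : lmodType k).
Local Notation L := (linop V).

HB.instance Definition _ := gen_eqMixin L.
HB.instance Definition _ := gen_choiceMixin L.
HB.instance Definition _ (f : L) := GRing.isLinear.Build k V V *:%R f (linop_linear f).

Lemma linopP (f g : L) : f =1 g -> f = g.
Proof.
case: f g => f lf [g lg] /= /funext E; rewrite E in lf *.
by congr Linop; exact: Prop_irrelevance.
Qed.

Definition linop_of (f : {linear V -> V}) : L := Linop (linearP f).
Definition linop_zero := linop_of \0.
Definition linop_add (f g : L) := linop_of (f \+ g).
Definition linop_opp (f : L) := linop_of (\- f).
Definition linop_scale c (f : L) := linop_of (c \*: f).
Definition linop_one := linop_of idfun.
Definition linop_mul (f g : L) := linop_of (f \o g).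

Fact linop_addA : associative linop_add.
Proof. by move=> f g h; apply: linopP => v; exact: addrA. Qed.
Fact linop_addC : commutative linop_add.
Proof. by move=> f g; apply: linopP => v; exact: addrC. Qed.
Fact linop_add0 : left_id linop_zero linop_add.
Proof. by move=> f; apply: linopP => v; exact: add0r. Qed.
Fact linop_addN : left_inverse linop_zero linop_opp linop_add.
Proof. by move=> f; apply: linopP => v; exact: addNr. Qed.
HB.instance Definition _ := GRing.isZmodule.Build L linop_addA linop_addC linop_add0 linop_addN.

Fact linop_scaleA a b f : linop_scale a (linop_scale b f) = linop_scale (a * b) f.
Proof. by apply: linopP => v; exact: scalerA. Qed.
Fact linop_scale1 : left_id 1 linop_scale.
Proof. by move=> f; apply: linopP => v; exact: scale1r. Qed.
Fact linop_scaleDr : right_distributive linop_scale +%R.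
Proof. by move=> a f g; apply: linopP => v; exact: scalerDr. Qed.
Fact linop_scaleDl f : {morph linop_scale^~ f : a b / a + b}.
Proof. by move=> a b; apply: linopP => v; exact: scalerDl. Qed.
HB.instance Definition _ := GRing.Zmodule_isLmodule.Build k L
  linop_scaleA linop_scale1 linop_scaleDr linop_scaleDl.

End Linop.

Section LinopAlg.
Variables (k : fieldType) (A : algType k).
Local Notation L := (linop A).

Fact linop_mulA : associative (@linop_mul k A).
Proof. by move=> f g h; apply: linopP. Qed.
Fact linop_mul1 : left_id (@linop_one k A) (@linop_mul k A).
Proof. by move=> f; apply: linopP. Qed.
Fact linop_mulr1 : right_id (@linop_one k A) (@linop_mul k A).
Proof. by move=> f; apply: linopP. Qed.
Fact linop_mulDl : left_distributive (@linop_mul k A) +%R.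
Proof. by move=> f g h; apply: linopP. Qed.
Fact linop_mulDr : right_distributive (@linop_mul k A) +%R.
Proof. by move=> f g h; apply: linopP => a; exact: linearD. Qed.
Fact linop_one_neq0 : @linop_one k A != 0.
Proof. by apply/eqP => /(congr1 (fun f : L => f 1)) /eqP; rewrite oner_eq0. Qed.
HB.instance Definition _ := GRing.Zmodule_isNzRing.Build L
  linop_mulA linop_mul1 linop_mulr1 linop_mulDl linop_mulDr linop_one_neq0.

Fact linop_scaleAl c (f g : L) : c *: (f * g) = c *: f * g.
Proof. exact: linopP. Qed.
Fact linop_scaleAr c (f g : L) : c *: (f * g) = f * (c *: g).
Proof. by apply: linopP => a; apply: esym; exact: linearZ. Qed.
HB.instance Definition _ := GRing.Lmodule_isLalgebra.Build k L linop_scaleAl.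
HB.instance Definition _ := GRing.Lalgebra_isAlgebra.Build k L linop_scaleAr.

Lemma linopDE (f g : L) a : (f + g) a = f a + g a. Proof. by []. Qed.
Lemma linopNE (f : L) a : (- f) a = - f a. Proof. by []. Qed.
Lemma linopZE c (f : L) a : (c *: f) a = c *: f a. Proof. by []. Qed.
Lemma linopME (f g : L) a : (f * g) a = f (g a). Proof. by []. Qed.
End LinopAlg.

(** * The DG algebra of graded endomorphisms *)

Section GradedEnd.
Variables (k : fieldType) (A : dgAlgType k).
Local Notation L := (linop A).

Fact linop_gcomp_linear n (F : L) : linear (glift (fun i v => gcomp (n + i) (F v)) : A -> A).
Proof. by apply: glift_is_linear => i c x y; rewrite !linearP. Qed.
Definition linop_gcomp n (F : L) : L := Linop (linop_gcomp_linear n F).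

Lemma linop_gcompE n (F : L) i a : homog i a -> linop_gcomp n F a = gcomp (n + i) (F a).
Proof. by move=> ha; apply: (glift_homog _ ha) => j; rewrite !linear0. Qed.

Lemma linop_ext_homog (F G : L) : (forall i a, homog i a -> F a = G a) -> F = G.
Proof.
move=> H; apply: linopP; elim/homog_ind => [//|x y Hx Hy].
by rewrite !linearD /= Hx Hy.
Qed.

Lemma linop_homogP n (F : L) :
  linop_gcomp n F = F <-> forall i a, homog i a -> homog (n + i) (F a).
Proof.
split=> [<- i a ha|H]; first by rewrite (linop_gcompE _ _ ha); exact: homog_gcomp.
by apply: linop_ext_homog => i a ha; rewrite (linop_gcompE _ _ ha); exact: H.
Qed.

Definition linop_sigma : L := linop_of (@sigma k A 1).
Definition linop_d : L := linop_of (@dgd k A).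

(** The graded commutator with the differential: conjugation by the sign operator
    multiplies an operator of degree [n] by (-1)^n, so d F - (-1)^n F d needs
    no decomposition of [F]. *)
Definition linop_dgd (F : L) : L := linop_d * F - linop_sigma * F * linop_sigma * linop_d.

(** An arbitrary operator may have infinitely many components; the graded
    endomorphisms are the finite sums of homogeneous operators. *)
Definition linop_fin : {pred L} := fun F =>
  `[< exists s : seq int, uniq s && (F == \sum_(n <- s) linop_gcomp n F) >].

Fact linop_gcomp_is_linear n : linear (linop_gcomp n).
Proof.
move=> c F G; apply: linop_ext_homog => i a ha.
by rewrite linopDE linopZE !(linop_gcompE _ _ ha) linopDE linopZE linearP.
Qed.
HB.instance Definition _ n :=
  GRing.isLinear.Build k L L *:%R (linop_gcomp n) (linop_gcomp_is_linear n).

Fact linop_gcompK i j F : linop_gcomp i (linop_gcomp j F) = if i == j then linop_gcomp j F else 0.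
Proof.
apply: linop_ext_homog => l a ha; rewrite (linop_gcompE _ _ ha) (linop_gcompE _ _ ha) gcompK.
rewrite (inj_eq (addIr l)); by case: eqP => // _; rewrite (linop_gcompE _ _ ha).
Qed.

Lemma linop_fin_homog n F : linop_gcomp n F = F -> F \in linop_fin.
Proof. by move=> hF; apply/asboolP; exists [:: n]; rewrite big_seq1 hF eqxx. Qed.

Lemma linop_finP F : F \in linop_fin -> exists s : seq int, F = \sum_(n <- s) linop_gcomp n F.
Proof. by move/asboolP => [s /andP[_ /eqP FE]]; exists s. Qed.

Lemma linop_finD F G : F \in linop_fin -> G \in linop_fin -> F + G \in linop_fin.
Proof.
have D (s : seq int) (x : L) n : uniq s -> x = \sum_(i <- s) linop_gcomp i x ->
    n \notin s -> linop_gcomp n x = 0.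
  move=> us -> ns; rewrite linear_sum big1_seq // => i /andP[_ si].
  by rewrite /= linop_gcompK; case: eqP => // ni; rewrite ni si in ns.
move=> /asboolP [s /andP[us /eqP xE]] /asboolP [t /andP[ut /eqP yE]]; apply/asboolP.
exists (undup (s ++ t)); rewrite undup_uniq /=; apply/eqP.
under eq_bigr do rewrite linearD /=.
rewrite big_split /= [in LHS]xE [in LHS]yE; congr (_ + _).
- apply: sum_uniq_sub; rewrite ?undup_uniq // => n ns; last exact: (D s).
  by rewrite mem_undup mem_cat ns.
- apply: sum_uniq_sub; rewrite ?undup_uniq // => n ns; last exact: (D t).
  by rewrite mem_undup mem_cat ns orbT.
Qed.

Lemma linop_fin0 : 0 \in linop_fin.
Proof. by apply: (@linop_fin_homog 0 0); exact: linear0. Qed.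

Lemma linop_fin_sum (s : seq int) (F : int -> L) :
  (forall n, F n \in linop_fin) -> \sum_(n <- s) F n \in linop_fin.
Proof.
move=> H; apply: (big_ind (fun x => x \in linop_fin)) => //; first exact: linop_fin0.
exact: linop_finD.
Qed.

Lemma linop_gcompM i j F G :
  linop_gcomp i F = F -> linop_gcomp j G = G -> linop_gcomp (i + j) (F * G) = F * G.
Proof.
move=> /linop_homogP hF /linop_homogP hG; apply/linop_homogP => l a ha.
by rewrite linopME -addrA; exact/hF/hG.
Qed.

Lemma linop_sigma_homog n F : linop_gcomp n F = F ->
  linop_sigma * F = ksign n *: (F * linop_sigma).
Proof.
move/linop_homogP => hF; apply: linop_ext_homog => i a ha.
rewrite linopZE !linopME /= (sigmaE _ (hF _ _ ha)) (sigmaE _ ha) linearZ /= scalerA -ksignD.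
by rewrite !mul1r.
Qed.

Lemma linop_gcomp1 : linop_gcomp 0 1 = 1.
Proof. by apply/linop_homogP => i a ha; rewrite add0r. Qed.

Lemma linop_gcomp_sigma : linop_gcomp 0 linop_sigma = linop_sigma.
Proof. by apply/linop_homogP => i a ha; rewrite add0r /= (sigmaE _ ha); exact: homogZ. Qed.

Lemma linop_gcomp_d : linop_gcomp 1 linop_d = linop_d.
Proof. by apply/linop_homogP => i a ha; rewrite addrC; exact: homog_dgd. Qed.

Lemma linop_sigmaK : linop_sigma * linop_sigma = 1.
Proof.
apply: linop_ext_homog => i a ha.
by rewrite linopME /= (sigmaE _ ha) linearZ /= (sigmaE _ ha) scalerA ksignK scale1r.
Qed.

Lemma linop_dK : linop_d * linop_d = 0.
Proof. by apply: linopP => a; exact: dgdK. Qed.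

Lemma linop_sigma_d : linop_sigma * linop_d = - (linop_d * linop_sigma).
Proof. by rewrite (linop_sigma_homog linop_gcomp_d) ksign1 scaleN1r. Qed.

Fact linop_dgd_is_linear : linear linop_dgd.
Proof.
move=> c F G; rewrite /linop_dgd !(mulrDl, mulrDr) -!(scalerAl, scalerAr).
by rewrite opprD scalerBr addrACA.
Qed.

Fact linop_homog_dgd n F : linop_gcomp n F = F -> linop_gcomp (n + 1) (linop_dgd F) = linop_dgd F.
Proof.
move=> hF; rewrite /linop_dgd linearB /=; congr (_ - _).
  by rewrite [n + 1]addrC; apply: linop_gcompM => //; exact: linop_gcomp_d.
apply: linop_gcompM; last exact: linop_gcomp_d.
rewrite -[n]addr0; apply: linop_gcompM; last exact: linop_gcomp_sigma.
by rewrite -[n]add0r; apply: linop_gcompM => //; exact: linop_gcomp_sigma.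
Qed.

Fact linop_dgdK F : linop_dgd (linop_dgd F) = 0.
Proof.
have E G : G * linop_sigma * linop_d * linop_sigma * linop_d = 0.
  rewrite -[_ * linop_sigma * linop_d]mulrA linop_sigma_d mulrN -!mulrA.
  by rewrite [linop_d * (linop_d * _)]mulrA linop_dK mul0r !mulr0 oppr0.
rewrite /linop_dgd !(mulrBl, mulrBr) !mulrA linop_dK mul0r sub0r E subr0 linop_sigma_d.
by rewrite !mulNr opprK addNr.
Qed.

Fact linop_dgdM n F G : linop_gcomp n F = F ->
  linop_dgd (F * G) = linop_dgd F * G + ksign n *: (F * linop_dgd G).
Proof.
move=> hF; rewrite /linop_dgd mulrBl mulrBr scalerBr !mulrA (linop_sigma_homog hF).
have -> : ksign n *: (F * linop_sigma) * linop_sigma = ksign n *: F.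
  by rewrite -scalerAl -mulrA linop_sigmaK mulr1.
by rewrite -!scalerAl addrA subrK.
Qed.

Lemma linop_dg_closed : dg_closed linop_gcomp linop_dgd linop_fin.
Proof.
split; [|exact: linop_gcomp_is_linear| | | | | | | | | |exact: linop_dgdM].
- split; first exact: (linop_fin_homog linop_gcomp1).
    move=> c F G hF hG; apply: linop_finD => //; have [s ->] := linop_finP hF.
    rewrite scaler_sumr; apply: linop_fin_sum => n.
    by apply: (@linop_fin_homog n); rewrite linearZ /= linop_gcompK eqxx.
  move=> F G /linop_finP [s ->] /linop_finP [t ->].
  rewrite mulr_suml; apply: linop_fin_sum => n; rewrite mulr_sumr; apply: linop_fin_sum => m.
  by apply: (@linop_fin_homog (n + m)); apply: linop_gcompM; rewrite linop_gcompK eqxx.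
- by move=> n F _; apply: (@linop_fin_homog n); rewrite linop_gcompK eqxx.
- exact: linop_gcompK.
- by move=> F /asboolP.
- exact: linop_gcomp1.
- exact: linop_gcompM.
- exact: linop_dgd_is_linear.
- move=> F /linop_finP [s ->].
  have -> : linop_dgd (\sum_(n <- s) linop_gcomp n F) = \sum_(n <- s) linop_dgd (linop_gcomp n F).
    have D0 : linop_dgd 0 = 0 by rewrite /linop_dgd !(mulr0, mul0r) subr0.
    apply: (big_morph linop_dgd _ D0) => X Y.
    by have := linop_dgd_is_linear 1 X Y; rewrite !scale1r.
  apply: linop_fin_sum => n; apply: (@linop_fin_homog (n + 1)).
  by apply: linop_homog_dgd; rewrite linop_gcompK eqxx.
- exact: linop_homog_dgd.
- exact: linop_dgdK.
Qed.

End GradedEnd.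

(** * The Poisson algebra acts faithfully on itself *)

Section Faithful.
Variables (k : fieldType) (A : dgAlgType k) (br : {linear tensor A A -> A}).
Hypothesis hP : dg_poisson_algebra br.
Local Notation B := (dgsub (linop_dg_closed A)).

Fact lmul_linear (a : A) : linear (fun b : A => a * b).
Proof. by move=> c x y; rewrite mulrDr scalerAr. Qed.
Definition linop_lmul (a : A) : linop A := Linop (lmul_linear a).

(** The Hamiltonian derivation {a, -}. *)
Definition linop_ham (a : A) : linop A := linop_of (br \o pure a).

Fact linop_lmul_homog i a : homog i a -> linop_gcomp i (linop_lmul a) = linop_lmul a.
Proof. by move=> ha; apply/linop_homogP => j b hb; exact: homogM. Qed.

Fact linop_ham_homog i a : homog i a -> linop_gcomp i (linop_ham a) = linop_ham a.
Proof. by move=> ha; apply/linop_homogP => j b hb; exact/(br_deg0 hP)/homog_pure. Qed.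

Lemma linop_lmulD a b : linop_lmul (a + b) = linop_lmul a + linop_lmul b.
Proof. by apply: linopP => c; exact: mulrDl. Qed.

Lemma linop_hamD a b : linop_ham (a + b) = linop_ham a + linop_ham b.
Proof. by apply: linopP => c; rewrite /= pureDl linearD. Qed.

Fact linop_lmul_fin a : linop_lmul a \in @linop_fin k A.
Proof.
elim/homog_ind: a => [i a ha|a b Ha Hb]; first exact: linop_fin_homog (linop_lmul_homog ha).
by rewrite linop_lmulD; exact: linop_finD.
Qed.

Fact linop_ham_fin a : linop_ham a \in @linop_fin k A.
Proof.
elim/homog_ind: a => [i a ha|a b Ha Hb]; first exact: linop_fin_homog (linop_ham_homog ha).
by rewrite linop_hamD; exact: linop_finD.
Qed.

Definition end_mul (a : A) : B := Sub (linop_lmul a) (linop_lmul_fin a).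
Definition end_ham (a : A) : B := Sub (linop_ham a) (linop_ham_fin a).

Lemma end_eq (x y : B) : (forall i a, homog i a -> val x a = val y a) -> x = y.
Proof. by move=> H; apply/val_inj/linop_ext_homog. Qed.

Lemma linop_dgdE i (F : linop A) b : linop_gcomp i F = F ->
  linop_dgd F b = dgd (F b) - ksign i *: F (dgd b).
Proof.
move=> hF; rewrite /linop_dgd linopDE linopNE !linopME -!linopME.
by rewrite (linop_sigma_homog hF) -scalerAl -[F * _ * _]mulrA linop_sigmaK mulr1.
Qed.

Fact end_mul_linear : linear end_mul.
Proof. by move=> c a b; apply: end_eq => i x hx; rewrite [LHS]mulrDl -scalerAl. Qed.
HB.instance Definition _ := GRing.isLinear.Build k A B *:%R end_mul end_mul_linear.

Fact end_ham_linear : linear end_ham.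
Proof. by move=> c a b; apply: end_eq => i x hx; rewrite /= pureDl pureZl linearP. Qed.
HB.instance Definition _ := GRing.isLinear.Build k A B *:%R end_ham end_ham_linear.

(** The relations of the enveloping algebra, evaluated on an element of [A], are
    the axioms of a Poisson algebra: associativity, the Jacobi identity and
    the Leibniz rule in either argument. *)
Lemma end_env_pair : env_pair br end_mul end_ham.
Proof.
split.
- split; first split.
  + exact: end_mul_linear.
  + by move=> n a ha; apply/dgsub_homog/linop_lmul_homog.
  + by apply: end_eq => i x hx; exact: mul1r.
  + by move=> a b; apply: end_eq => i x hx; rewrite [LHS]/= -mulrA.
  + elim/homog_ind => [i a ha|a b Ha Hb]; last by rewrite !linearD /= Ha Hb.
    apply: end_eq => j x hx; apply: esym.
    rewrite [LHS](linop_dgdE _ (linop_lmul_homog ha)) /= (dgdM _ ha).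
    by rewrite addrK.
- split.
  + exact: end_ham_linear.
  + by move=> n a ha; apply/dgsub_homog/linop_ham_homog.
  + elim/homog_ind => [i a ha|a b Ha Hb]; last by rewrite !linearD /= Ha Hb.
    apply: end_eq => j x hx; apply: esym.
    rewrite [LHS](linop_dgdE _ (linop_ham_homog ha)) /= (br_dgd hP ha hx).
    by rewrite addrK.
  + move=> i j a b ha hb; apply: end_eq => l x hx.
    by rewrite [RHS]/= (br_jacobi hP ha hb hx) addrK.
- move=> i j a b ha hb; apply: end_eq => l x hx.
  by rewrite [RHS]/= (br_leibniz hP ha hb hx) addrK.
- move=> i j a b ha hb; apply: end_eq => l x hx.
  rewrite [LHS]/= (br_leibnizl hP ha hb hx) /=; congr (_ + _).
  rewrite (graded_comm hP (br_deg0 hP (homog_pure ha hx)) hb) scalerA -ksignD.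
  by congr (_ *: _); apply: (@ksign_eq _ (j * l)); ring.
Qed.

(** The action recovers a as the value at 1 of the operator attached to m(a). *)
Lemma env_mul_inj (Ae : dgAlgType k) (m h : A -> Ae) : univ_env br m h ->
  forall a, m a = 0 -> a = 0.
Proof.
move=> hAe a ma0; have [phi [[[phil _ _ _] _] phim _] _] := univ_env_lift hAe end_env_pair.
have : val (phi (m a)) 1 = a by rewrite [phi _]phim; exact: mulr1.
have phi0 : phi 0 = 0 by have := scalable_linear phil 0 0; rewrite /= !scale0r.
by rewrite ma0 phi0.
Qed.

End Faithful.

(** * Generation of the enveloping algebra *)

Section Generation.
Variables (k : fieldType) (A : dgAlgType k) (br : {linear tensor A A -> A}).
Variables (Ae : dgAlgType k) (m h : {linear A -> Ae}).

Inductive env_gen : Ae -> Prop :=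
| env_gen_m a : env_gen (m a)
| env_gen_h a : env_gen (h a)
| env_gen1 : env_gen 1
| env_gen_lin c x y : env_gen x -> env_gen y -> env_gen (c *: x + y)
| env_genM x y : env_gen x -> env_gen y -> env_gen (x * y).

Lemma env_gen0 : env_gen 0.
Proof. by rewrite -(linear0 m); exact: env_gen_m. Qed.

Lemma env_genD x y : env_gen x -> env_gen y -> env_gen (x + y).
Proof. by rewrite -{2}[x]scale1r; exact: env_gen_lin. Qed.

Lemma env_genZ c x : env_gen x -> env_gen (c *: x).
Proof. by move=> gx; rewrite -[_ *: _]addr0; apply: env_gen_lin => //; exact: env_gen0. Qed.

Lemma env_gen_sum (s : seq int) (F : int -> Ae) :
  (forall n, env_gen (F n)) -> env_gen (\sum_(n <- s) F n).
Proof. by move=> H; apply: (big_ind env_gen); [exact: env_gen0|exact: env_genD|]. Qed.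

Hypothesis hmh : env_pair br m h.

Lemma deg0_gcomp (V W : gLmodType k) (f : {linear V -> W}) n v :
  deg0 f -> gcomp n (f v) = f (gcomp n v).
Proof.
move=> hf; elim/homog_ind: v => [i v hv|v w Hv Hw]; last by rewrite !linearD /= Hv Hw.
by rewrite (gcomp_homog _ hv) (gcomp_homog _ (hf _ _ hv)); case: eqP; rewrite ?linear0.
Qed.

(** Homogeneous components of generators are generators, and those of a product are
    sums of products of components. *)
Lemma env_gen_gcomp n x : env_gen x -> env_gen (gcomp n x).
Proof.
move=> gx; elim: gx n => [a|a||c {}x y _ Hx _ Hy|{}x y _ Hx _ Hy] n.
- rewrite deg0_gcomp; first exact: env_gen_m.
  exact: alg_hom_deg0 (dg_alg_hom_graded (env_alg_hom hmh)).
- rewrite deg0_gcomp; first exact: env_gen_h.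
  exact: lie_hom_deg0 (env_lie_hom hmh).
- by rewrite (gcomp_homog _ (homog1 Ae)); case: eqP => _; [exact: env_gen1|exact: env_gen0].
- by rewrite linearP /=; apply: env_gen_lin.
- rewrite [x]gcomp_sum [y]gcomp_sum mulr_suml linear_sum; apply: env_gen_sum => i.
  rewrite mulr_sumr linear_sum; apply: env_gen_sum => j /=.
  rewrite (gcomp_homog _ (homogM (homog_gcomp i x) (homog_gcomp j y))).
  by case: eqP => _; [exact: env_genM|exact: env_gen0].
Qed.

(** The Leibniz rule applies to a homogeneous first factor, hence the decomposition
    of [x]; d(x_i) is a component of d(x). *)
Lemma env_gen_dgd x : env_gen x -> env_gen (dgd x).
Proof.
elim=> [a|a||c {}x y _ Hx _ Hy|{}x y gx Hx gy Hy].
- rewrite -(dg_alg_homd (env_alg_hom hmh)); exact: env_gen_m.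
- rewrite -(lie_homd (env_lie_hom hmh)); exact: env_gen_h.
- by rewrite dgd1; exact: env_gen0.
- by rewrite linearP /=; apply: env_gen_lin.
- rewrite [x]gcomp_sum mulr_suml linear_sum; apply: env_gen_sum => i.
  rewrite /= (dgdM _ (homog_gcomp i x)); apply: env_genD; last first.
    by apply/env_genZ/env_genM => //; exact: env_gen_gcomp.
  apply: env_genM => //.
  suff -> : dgd (gcomp i x) = gcomp (i + 1) (dgd x) by exact: env_gen_gcomp.
  elim/homog_ind: (x) => [j v hv|v w Hv Hw]; last by rewrite !linearD /= Hv Hw.
  rewrite (gcomp_homog _ hv) (gcomp_homog _ (homog_dgd hv)) (inj_eq (addIr 1)).
  by case: eqP; rewrite ?linear0.
Qed.

Definition env_gen_pred : {pred Ae} := fun x => `[< env_gen x >].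

Lemma env_gen_closed : dg_closed (fun n => @gcomp k Ae n) dgd env_gen_pred.
Proof.
split.
- split; first exact/asboolP/env_gen1.
    by move=> c x y /asboolP hx /asboolP hy; apply/asboolP/env_gen_lin.
  by move=> x y /asboolP hx /asboolP hy; apply/asboolP/env_genM.
- exact: gcomp_is_linear.
- by move=> n x /asboolP hx; apply/asboolP/env_gen_gcomp.
- exact: gcompK.
- by move=> x _; exact: gcomp_fin.
- exact: homog1.
- by move=> i j x y; exact: homogM.
- exact: dgd_is_linear.
- by move=> x /asboolP hx; apply/asboolP/env_gen_dgd.
- by move=> n x; exact: homog_dgd.
- exact: dgdK.
- by move=> n x y; exact: dgdM.
Qed.

(** The pair (m, h) factors through the generated DG subalgebra; the resulting map,
    followed by the inclusion, is the identity by uniqueness. *)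
Lemma univ_env_gen : univ_env br m h -> forall x, env_gen x.
Proof.
move=> hAe x; pose B := dgsub env_gen_closed.
pose mB a : B := Sub (m a) (introT (asboolP _) (env_gen_m a)).
pose hB a : B := Sub (h a) (introT (asboolP _) (env_gen_h a)).
have [[[ml m0 m1 mM] md] [hl h0 hd hbr] e1 e2] := hmh.
have pB : env_pair br mB hB.
  split.
  - split; first split.
    + by move=> c a b; apply: val_inj; exact: ml.
    + by move=> n a ha; apply/dgsub_homog/m0.
    + by apply: val_inj; exact: m1.
    + by move=> a b; apply: val_inj; exact: mM.
    + by move=> a; apply: val_inj; exact: md.
  - split.
    + by move=> c a b; apply: val_inj; exact: hl.
    + by move=> n a ha; apply/dgsub_homog/h0.
    + by move=> a; apply: val_inj; exact: hd.
    + by move=> i j a b ha hb; apply: val_inj; exact: hbr.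
  - by move=> i j a b ha hb; apply: val_inj; exact: e1.
  - by move=> i j a b ha hb; apply: val_inj; exact: e2.
have [phi [[[pl p0 p1 pM] pd] pm ph] _] := univ_env_lift hAe pB.
(* Every DG algebra endomorphism of Ae that fixes m and h equals id'. *)
have [id' _ idU] := univ_env_lift hAe hmh.
have -> : x = val (phi x); last by have /asboolP := valP (phi x).
rewrite [RHS](idU (fun x => val (phi x))); last first.
  split; last 2 first.
  - by move=> a /=; rewrite [phi _]pm.
  - by move=> a /=; rewrite [phi _]ph.
  split; first split.
  - by move=> c u v; rewrite pl.
  - by move=> n u hu; exact/dgsub_homog/p0.
  - by rewrite p1.
  - by move=> u v; rewrite pM.
  - by move=> u; rewrite pd.
by apply: (idU id); split=> //; split=> //; split.
Qed.

Lemma env_ind (P : Ae -> Prop) : univ_env br m h ->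
  (forall a, P (m a)) -> (forall a, P (h a)) -> P 1 ->
  (forall c x y, P x -> P y -> P (c *: x + y)) ->
  (forall x y, P x -> P y -> P (x * y)) -> forall x, P x.
Proof.
move=> hAe Pm Ph P1 Pl PM x; elim: {x}(univ_env_gen hAe x) => //.
- by move=> c x y _ Px _ Py; exact: Pl.
- by move=> x y _ Px _ Py; exact: PM.
Qed.

End Generation.

(** * Tensor products of algebra maps *)

Section TensorAlgMaps.
Variables (k : fieldType) (A A' B B' C : gAlgType k).

Lemma tmapM (f : {linear A -> A'}) (g : {linear B -> B'}) x y :
  graded_alg_hom f -> graded_alg_hom g ->
  tmap f g (x * y) = tmap f g x * tmap f g y.
Proof.
move=> hf hg; elim/tensor_homog_ind: x => [i j a b ha hb|x x' Hx Hx']; last first.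
  by rewrite mulrDl !linearD /= mulrDl Hx Hx'.
elim/tensor_homog_ind: y => [i' j' a' b' ha' hb'|y y' Hy Hy']; last first.
  by rewrite mulrDr !linearD /= mulrDr Hy Hy'.
rewrite (tensor_mulE _ _ hb ha') linearZ /= !tmapE (alg_homM hf) (alg_homM hg).
by rewrite (tensor_mulE _ _ (alg_hom_deg0 hg hb) (alg_hom_deg0 hf ha')).
Qed.

Lemma tassocM (x y : (A ⊗ B) ⊗ C) : tassoc (x * y) = tassoc x * tassoc y.
Proof.
have ind (P : (A ⊗ B) ⊗ C -> Prop) :
    (forall i j l a b c, homog i a -> homog j b -> homog l c -> P ((a ⊗ b) ⊗ c)) ->
    (forall x y, P x -> P y -> P (x + y)) -> forall x, P x.
  move=> Ph PD; elim/tensor_ind => [u c|]; last exact: PD.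
  elim/homog_ind: c => [l c hc|c c' Hc Hc']; last by rewrite pureDr; exact: PD.
  elim/tensor_homog_ind: u => [i j a b ha hb|u u' Hu Hu']; last by rewrite pureDl; exact: PD.
  exact: Ph ha hb hc.
elim/ind: x => [i j l a b c ha hb hc|x x' Hx Hx']; last first.
  by rewrite mulrDl !linearD /= mulrDl Hx Hx'.
elim/ind: y => [i' j' l' a' b' c' ha' hb' hc'|y y' Hy Hy']; last first.
  by rewrite mulrDr !linearD /= mulrDr Hy Hy'.
rewrite !tassocE (tensor_mulE _ _ hc (homog_pure ha' hb')) (tensor_mulE _ _ hb ha').
rewrite (tensor_mulE _ _ (homog_pure hb hc) ha') (tensor_mulE _ _ hc hb').
rewrite pureZl !linearZ /= tassocE !scalerA -!ksignD; congr (ksign _ *: _); ring.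
Qed.

Lemma tunitlM (x y : k^o ⊗ A) : tunitl (x * y) = tunitl x * tunitl y.
Proof.
elim/tensor_homog_ind: x => [i j a b ha hb|x x' Hx Hx']; last first.
  by rewrite mulrDl !linearD /= mulrDl Hx Hx'.
elim/tensor_homog_ind: y => [i' j' a' b' ha' hb'|y y' Hy Hy']; last first.
  by rewrite mulrDr !linearD /= mulrDr Hy Hy'.
rewrite (tensor_mulE _ _ hb ha') linearZ /= !tunitlE -scalerAl -scalerAr !scalerA.
case/homog_ground: ha' => ->; last by rewrite !mulr0 !scale0r.
by rewrite mulr0 ksign0 mul1r.
Qed.

Lemma tunitrM (x y : A ⊗ k^o) : tunitr (x * y) = tunitr x * tunitr y.
Proof.
elim/tensor_homog_ind: x => [i j a b ha hb|x x' Hx Hx']; last first.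
  by rewrite mulrDl !linearD /= mulrDl Hx Hx'.
elim/tensor_homog_ind: y => [i' j' a' b' ha' hb'|y y' Hy Hy']; last first.
  by rewrite mulrDr !linearD /= mulrDr Hy Hy'.
rewrite (tensor_mulE _ _ hb ha') linearZ /= !tunitrE -scalerAl -scalerAr !scalerA.
case/homog_ground: hb => ->; last by rewrite !mul0r mulr0 !scale0r.
by rewrite mul0r ksign0 mul1r.
Qed.

End TensorAlgMaps.

Section TmapAdd.
Variables (k : fieldType) (V V' W W' : lmodType k).

Lemma tmapDl (f f' : {linear V -> V'}) (g : {linear W -> W'}) x :
  tmap (f \+ f') g x = tmap f g x + tmap f' g x.
Proof.
elim/tensor_ind: x => [v w|x y Hx Hy]; first by rewrite !tmapE pureDl.
by rewrite !linearD /= Hx Hy addrACA.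
Qed.

Lemma tmapDr (f : {linear V -> V'}) (g g' : {linear W -> W'}) x :
  tmap f (g \+ g') x = tmap f g x + tmap f g' x.
Proof.
elim/tensor_ind: x => [v w|x y Hx Hy]; first by rewrite !tmapE pureDr.
by rewrite !linearD /= Hx Hy addrACA.
Qed.

End TmapAdd.

Lemma graded_alg_hom_id (k : fieldType) (A : gAlgType k) : graded_alg_hom (@idfun A).
Proof. by split. Qed.

(** The right-hand side is the form in which the coderivation axiom of a bialgebra
    is stated. *)
Lemma tensor_dgd_twist (k : fieldType) (V : dgLmodType k) (x : V ⊗ V) :
  dgd x = tmap dgd idfun x + twist (tmap dgd idfun (twist x)).
Proof.
elim/tensor_homog_ind: x => [i j v w hv hw|x y Hx Hy]; last first.
  by rewrite !linearD /= Hx Hy addrACA.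
rewrite (tensor_dgdE _ hv) (twistE hv hw) !linearZ /= !tmapE (twistE (homog_dgd hw) hv).
rewrite scalerA -ksignD; congr (_ + _ *: _); apply: esym.
by apply: (@ksign_eq _ (i * j)); ring.
Qed.

(** * Antipode identities on products *)

Section AntiMult.
Variables (k : fieldType) (H : gAlgType k) (S : {linear H -> H}).
Hypotheses (S0 : deg0 S) (SM : forall i j (a b : H), homog i a -> homog j b ->
  S (a * b) = ksign (i * j) *: (S b * S a)).

(** S(x1 y1) x2 y2 = (+/-) S(y1) (S(x1) x2) y2, and moving w = S(x1) x2 past y1
    is what the product with 1 and w in the tensor square does, with the same
    sign. If w is a scalar then it factors out. *)
Lemma antipodel_mul (X Y : H ⊗ H) :
  mult (tmap S idfun (X * Y)) =
  mult (tmap S idfun ((1 ⊗ mult (tmap S idfun X)) * Y)).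
Proof.
elim/tensor_homog_ind: X => [i j a b ha hb|x x' Hx Hx']; last first.
  by rewrite mulrDl !linearD /= mulrDl !linearD /= Hx Hx'.
elim/tensor_homog_ind: Y => [p q c d hc hd|y y' Hy Hy']; last first.
  by rewrite !mulrDr !linearD /= Hy Hy'.
rewrite tmapE Defs.multE (tensor_mulE _ _ hb hc).
rewrite (tensor_mulE _ _ (homogM (S0 ha) hb) hc) !linearZ /= !tmapE !Defs.multE /=.
rewrite (SM ha hc) mul1r -scalerAl scalerA -ksignD !mulrA; congr (ksign _ *: _); ring.
Qed.

Lemma antipoder_mul (X Y : H ⊗ H) :
  mult (tmap idfun S (X * Y)) =
  mult (tmap idfun S (X * (mult (tmap idfun S Y) ⊗ 1))).
Proof.
elim/tensor_homog_ind: X => [i j a b ha hb|x x' Hx Hx']; last first.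
  by rewrite !mulrDl !linearD /= Hx Hx'.
elim/tensor_homog_ind: Y => [p q c d hc hd|y y' Hy Hy']; last first.
  by rewrite mulrDr !linearD /= pureDl mulrDr !linearD /= Hy Hy'.
rewrite tmapE Defs.multE (tensor_mulE _ _ hb hc).
rewrite (tensor_mulE _ _ hb (homogM hc (S0 hd))) !linearZ /= !tmapE !Defs.multE /=.
rewrite (SM hb hd) mulr1 -scalerAr scalerA -ksignD !mulrA; congr (ksign _ *: _); ring.
Qed.

End AntiMult.

(** * The bialgebra structure of the enveloping algebra *)

Section EnvHopf.
Variables (k : fieldType) (A : dgAlgType k) (br : {linear tensor A A -> A}).
Variables (Ae : dgAlgType k) (m h : {linear A -> Ae}).
Hypothesis hAe : univ_env br m h.
Let hmh := univ_env_pair hAe.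

Lemma env_hom_ext (B : algType k) (f g : {linear Ae -> B}) :
  f 1 = 1 -> (forall x y, f (x * y) = f x * f y) ->
  g 1 = 1 -> (forall x y, g (x * y) = g x * g y) ->
  (forall a, f (m a) = g (m a)) -> (forall a, f (h a) = g (h a)) -> f =1 g.
Proof.
move=> f1 fM g1 gM em eh; apply: (env_ind hmh hAe) => //; first by rewrite f1 g1.
  by move=> c x y Hx Hy; rewrite !linearP Hx Hy.
by move=> x y Hx Hy; rewrite fM gM Hx Hy.
Qed.

(** The defining relations for h(ab) and m{a, b}, added up: the terms m(b) h(a)
    cancel. *)
Lemma env_m_h_mult z :
  mult (tmap m h z) + mult (tmap h m z) = h (mult z) + m (br z).
Proof.
elim/tensor_homog_ind: z => [i j a b ha hb|x y Hx Hy]; last first.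
  by rewrite !linearD /= addrACA Hx Hy addrACA.
rewrite !tmapE !Defs.multE (env_mul hmh ha hb) (env_br hmh ha hb).
by rewrite [h a * _ - _]addrC addrA addrK.
Qed.

(** h(1) = h(1 1) = 2 h(1). *)
Lemma env_h1 : h 1 = 0.
Proof.
have := env_mul hmh (homog1 A) (homog1 A).
rewrite mulr1 (alg_hom1 (dg_alg_hom_graded (env_alg_hom hmh))) mulr0 ksign0 scale1r !mul1r.
by move/eqP; rewrite -subr_eq subrr eq_sym => /eqP.
Qed.

Section Bialgebra.
Variables (Delta : {linear A -> tensor A A}) (eps : {linear A -> k^o}).
Hypothesis hB : graded_bialgebra Delta eps.
Variables (Deltae : {linear Ae -> tensor Ae Ae}) (epse : {linear Ae -> k^o}).
Hypotheses (hDeltae : dg_alg_hom Deltae) (hepse : dg_alg_hom epse)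
    (Deltae_m : forall a, Deltae (m a) = tmap m m (Delta a))
    (Deltae_h : forall a, Deltae (h a) = tmap m h (Delta a) + tmap h m (Delta a))
    (epse_m : forall a, epse (m a) = eps a)
    (epse_h : forall a, epse (h a) = 0).
Let hD := dg_alg_hom_graded hDeltae.
Let he := dg_alg_hom_graded hepse.

(** Coassociativity of [Delta] with a map applied to each of the three factors;
    coassociativity on h(a) is the sum of three instances. *)
Lemma coassoc_tmap (f g p : {linear A -> Ae}) a :
  tassoc (tmap (tmap f g \o Delta) p (Delta a)) = tmap f (tmap g p \o Delta) (Delta a).
Proof.
have <- : tmap f (tmap g p) (tmap idfun Delta (Delta a)) =
    tmap f (tmap g p \o Delta) (Delta a) by rewrite tmap_comp; exact: eq_tmap.
rewrite -(coassoc hB).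
elim/tensor_ind: (Delta a) => [v w|x y Hx Hy]; last by rewrite !linearD /= Hx Hy.
rewrite !tmapE /=; elim/tensor_ind: (Delta v) => [v1 v2|x y Hx Hy].
  by rewrite tmapE !tassocE tmapE /= tmapE.
by rewrite linearD !pureDl !linearD /= Hx Hy.
Qed.

Lemma env_coassoc x :
  tassoc (tmap Deltae idfun (Deltae x)) = tmap idfun Deltae (Deltae x).
Proof.
have hid := graded_alg_hom_id Ae.
apply: (env_hom_ext (f := @tassoc k _ _ _ \o tmap Deltae idfun \o Deltae)
  (g := tmap idfun Deltae \o Deltae)) => /=.
- by rewrite (alg_hom1 hD) tensor_oneE tmapE (alg_hom1 hD) tassocE.
- by move=> {}x y; rewrite (alg_homM hD) (tmapM _ _ hD hid) tassocM.
- by rewrite (alg_hom1 hD) tensor_oneE tmapE (alg_hom1 hD).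
- by move=> {}x y; rewrite (alg_homM hD) (tmapM _ _ hid hD).
- move=> a; rewrite Deltae_m !tmap_comp.
  rewrite (eq_tmap (f' := tmap m m \o Delta) (g' := m)) // coassoc_tmap.
  by apply: eq_tmap => // b /=; rewrite Deltae_m.
- move=> a; rewrite Deltae_h !linearD /= !tmap_comp.
  rewrite (eq_tmap (f' := tmap m m \o Delta) (g' := h)) // coassoc_tmap.
  rewrite (eq_tmap (f := Deltae \o h) (g' := m)
    (f' := (tmap m h \o Delta) \+ (tmap h m \o Delta))) //.
  rewrite tmapDl linearD /= !coassoc_tmap.
  rewrite [X in _ = X + _](eq_tmap (f' := m)
    (g' := (tmap m h \o Delta) \+ (tmap h m \o Delta))) // tmapDr addrA.
  by congr (_ + _); apply: eq_tmap => // b /=; rewrite Deltae_m.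
Qed.

Lemma env_counitl x : tunitl (tmap epse idfun (Deltae x)) = x.
Proof.
have hid := graded_alg_hom_id Ae.
apply: (env_hom_ext (f := @tunitl k _ \o tmap epse idfun \o Deltae) (g := idfun)) => //=.
- by rewrite (alg_hom1 hD) tensor_oneE tmapE (alg_hom1 he) tunitlE scale1r.
- by move=> {}x y; rewrite (alg_homM hD) (tmapM _ _ he hid) tunitlM.
- move=> a; rewrite Deltae_m -[a in RHS](counitl hB).
  elim/tensor_ind: (Delta a) => [v w|y z Hy Hz]; last by rewrite !linearD /= Hy Hz.
  by rewrite !tmapE !tunitlE linearZ; congr (_ *: _); exact: epse_m.
- move=> a; rewrite Deltae_h -[a in RHS](counitl hB).
  elim/tensor_ind: (Delta a) => [v w|y z Hy Hz]; last first.
    by rewrite !linearD /= -Hy -Hz !linearD addrACA.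
  rewrite !linearD /= !tmapE /= !tunitlE [X in _ + X *: _ = _]epse_h scale0r addr0 linearZ.
  by congr (_ *: _); exact: epse_m.
Qed.

Lemma env_counitr x : tunitr (tmap idfun epse (Deltae x)) = x.
Proof.
have hid := graded_alg_hom_id Ae.
apply: (env_hom_ext (f := @tunitr k _ \o tmap idfun epse \o Deltae) (g := idfun)) => //=.
- by rewrite (alg_hom1 hD) tensor_oneE tmapE (alg_hom1 he) tunitrE scale1r.
- by move=> {}x y; rewrite (alg_homM hD) (tmapM _ _ hid he) tunitrM.
- move=> a; rewrite Deltae_m -[a in RHS](counitr hB).
  elim/tensor_ind: (Delta a) => [v w|y z Hy Hz]; last by rewrite !linearD /= Hy Hz.
  by rewrite !tmapE !tunitrE linearZ; congr (_ *: _); exact: epse_m.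
- move=> a; rewrite Deltae_h -[a in RHS](counitr hB).
  elim/tensor_ind: (Delta a) => [v w|y z Hy Hz]; last first.
    by rewrite !linearD /= -Hy -Hz !linearD addrACA.
  rewrite !linearD /= !tmapE /= !tunitrE [X in X *: _ + _ = _]epse_h scale0r add0r linearZ.
  by congr (_ *: _); exact: epse_m.
Qed.

Lemma env_dg_bialgebra : dg_bialgebra Deltae epse.
Proof.
split.
- by split; [exact: env_coassoc|exact: env_counitl|exact: env_counitr| |].
- by move=> x; rewrite (dg_alg_homd hepse).
- by move=> x; rewrite (dg_alg_homd hDeltae); exact: tensor_dgd_twist.
Qed.

End Bialgebra.
End EnvHopf.

(** * The antipode of the enveloping algebra *)

Section EnvAntipode.
Variables (k : fieldType) (A : dgAlgType k).
Variables (Delta : {linear A -> tensor A A}) (eps : {linear A -> k^o}) (S : {linear A -> A}).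
Variable br : {linear tensor A A -> A}.
Hypothesis hA : dg_poisson_hopf_algebra Delta eps S br.
Variables (Ae : dgAlgType k) (m h : {linear A -> Ae}).
Hypothesis hAe : univ_env br m h.
Let hP := dgph_poisson hA.
Let hB := dgph_bialgebra hA.
Let hS := dgph_antipode hA.
Let hmh := univ_env_pair hAe.
Let hm := env_alg_hom hmh.
Let hh := env_lie_hom hmh.
Let m0 := alg_hom_deg0 (dg_alg_hom_graded hm).
Let h0 := lie_hom_deg0 hh.
Let S0 := antipode_deg0 hS.
Let SM := antipodeM hB hS (graded_comm hP).
Let Sd := antipode_dgd hB hS (dgph_epsd hA) (dgph_Deltad hA).

(** Reversing products matches the sign in S{a, b} = - {S a, S b} for the relations
    with a bracket. For h(ab), the two sides differ by m{S a, S b} + (+/-) m{S b, S a},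
    which skew symmetry annihilates. *)
Lemma env_pair_op : env_pair br (m \o S : A -> gop Ae) (h \o S : A -> gop Ae).
Proof.
have sw i j : ksign (i * j) * ksign (i * j) = 1 :> k := ksignK k (i * j).
split.
- split; first split.
  + by move=> c a b; exact: (linearP (m \o S)).
  + by move=> n a ha; exact/m0/S0.
  + by rewrite /= (antipode1 hB hS) (alg_hom1 (dg_alg_hom_graded hm)).
  + have mSD u v : (m \o S) (u + v) = (m \o S) u + (m \o S) v :> gop Ae.
      by rewrite /= !linearD.
    elim/homog_ind => [i a ha|a a' Ha Ha'] b; last by rewrite mulrDl !mSD mulrDl Ha Ha'.
    elim/homog_ind: b => [j b hb|b b' Hb Hb']; last by rewrite mulrDr !mSD mulrDr Hb Hb'.
    rewrite (gop_mulE (m0 (S0 ha)) (m0 (S0 hb))) /= (graded_comm hP ha hb) !linearZ /= SM.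
    by rewrite (alg_homM (dg_alg_hom_graded hm)).
  + by move=> a /=; rewrite Sd (dg_alg_homd hm).
- split.
  + by move=> c a b; exact: (linearP (h \o S)).
  + by move=> n a ha; exact/h0/S0.
  + by move=> a /=; rewrite Sd (lie_homd hh).
  + move=> i j a b ha hb.
    rewrite (gop_mulE (h0 (S0 ha)) (h0 (S0 hb))) (gop_mulE (h0 (S0 hb)) (h0 (S0 ha))) /=.
    rewrite (antipode_br hA) linearN /= (lie_hom_br hh (S0 ha) (S0 hb)) opprB.
    by rewrite scalerA [j * i]mulrC sw scale1r.
- move=> i j a b ha hb.
  rewrite (gop_mulE (h0 (S0 ha)) (m0 (S0 hb))) (gop_mulE (m0 (S0 hb)) (h0 (S0 ha))) /=.
  rewrite (antipode_br hA) linearN /= (env_br hmh (S0 ha) (S0 hb)) opprB.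
  by rewrite scalerA [j * i]mulrC sw scale1r.
- move=> i j a b ha hb.
  rewrite (gop_mulE (m0 (S0 ha)) (h0 (S0 hb))) (gop_mulE (m0 (S0 hb)) (h0 (S0 ha))) /=.
  rewrite scalerA [j * i]mulrC sw scale1r SM (env_mul hmh (S0 ha) (S0 hb)).
  (* Exchange the factors, so that only m(-) h(-) and m{-, -} remain. *)
  have EA : h (S a) * m (S b) = m (br (S a ⊗ S b)) + ksign (i * j) *: (m (S b) * h (S a)).
    by rewrite (env_br hmh (S0 ha) (S0 hb)) subrK.
  have EB : h (S b) * m (S a) = m (br (S b ⊗ S a)) + ksign (i * j) *: (m (S a) * h (S b)).
    by rewrite (env_br hmh (S0 hb) (S0 ha)) [j * i]mulrC subrK.
  rewrite EA EB (br_skew hP (S0 ha) (S0 hb)) linearN linearZ /= scalerDr scalerA sw scale1r.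
  by rewrite addrC addrACA addrN add0r addrC.
Qed.

Lemma env_antipode_exists : exists Se : {linear Ae -> Ae},
  [/\ dg_alg_hom (Se : Ae -> gop Ae),
      (forall a, Se (m a) = m (S a)) & (forall a, Se (h a) = h (S a))].
Proof.
have [phi [phom pm ph] _] := univ_env_lift hAe env_pair_op.
have pl : linear (phi : Ae -> Ae) := alg_hom_linear (dg_alg_hom_graded phom).
pose phiL := GRing.isLinear.Build k Ae Ae *:%R (phi : Ae -> Ae) pl.
pose Se : {linear Ae -> Ae} := HB.pack (phi : Ae -> Ae) phiL.
by exists Se; split.
Qed.

Section Hopf.
Variables (Deltae : {linear Ae -> tensor Ae Ae}) (epse : {linear Ae -> k^o}).
Hypotheses (hDeltae : dg_alg_hom Deltae) (hepse : dg_alg_hom epse)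
    (Deltae_m : forall a, Deltae (m a) = tmap m m (Delta a))
    (Deltae_h : forall a, Deltae (h a) = tmap m h (Delta a) + tmap h m (Delta a))
    (epse_m : forall a, epse (m a) = eps a)
    (epse_h : forall a, epse (h a) = 0).
Variable Se : {linear Ae -> Ae}.
Hypotheses (hSe : dg_alg_hom (Se : Ae -> gop Ae))
  (Se_m : forall a, Se (m a) = m (S a)) (Se_h : forall a, Se (h a) = h (S a)).
Let hD := dg_alg_hom_graded hDeltae.
Let he := dg_alg_hom_graded hepse.
Let Se0 : deg0 Se := alg_hom_deg0 (dg_alg_hom_graded hSe).

Lemma anti_homM i j (a b : Ae) : homog i a -> homog j b ->
  Se (a * b) = ksign (i * j) *: (Se b * Se a).
Proof.
move=> ha hb; rewrite (alg_homM (dg_alg_hom_graded hSe)).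
exact: (gop_mulE (Se0 ha) (Se0 hb)).
Qed.

Let Se1 : Se 1 = 1 := alg_hom1 (dg_alg_hom_graded hSe).

Lemma env_antipodel_h a :
  mult (tmap Se idfun (Deltae (h a))) = m (br (tmap S idfun (Delta a))).
Proof.
rewrite Deltae_h !linearD /= !tmap_comp.
rewrite (eq_tmap (f' := m \o S) (g' := h)) //.
rewrite [X in _ + mult X](eq_tmap (f' := h \o S) (g' := m)) //.
rewrite -[tmap (m \o S) h _](tmap_comp m S h idfun) -[tmap (h \o S) m _](tmap_comp h S m idfun).
by rewrite (env_m_h_mult hAe) (antipodel hS) linearZ /= (env_h1 hAe) scaler0 add0r.
Qed.

Lemma env_antipoder_h a :
  mult (tmap idfun Se (Deltae (h a))) = m (br (tmap idfun S (Delta a))).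
Proof.
rewrite Deltae_h !linearD /= !tmap_comp.
rewrite (eq_tmap (f' := m) (g' := h \o S)) //.
rewrite [X in _ + mult X](eq_tmap (f' := h) (g' := m \o S)) //.
rewrite -[tmap m (h \o S) _](tmap_comp m idfun h S) -[tmap h (m \o S) _](tmap_comp h idfun m S).
by rewrite (env_m_h_mult hAe) (antipoder hS) linearZ /= (env_h1 hAe) scaler0 add0r.
Qed.

Lemma mult_tmap_m (z : A ⊗ A) : mult (tmap m m z) = m (mult z).
Proof.
elim/tensor_ind: z => [v w|x y Hx Hy]; last by rewrite !linearD /= Hx Hy.
by rewrite tmapE !Defs.multE (alg_homM (dg_alg_hom_graded hm)).
Qed.

Lemma env_is_antipode :
  (forall a, br (tmap S idfun (Delta a)) = 0) -> is_antipode Deltae epse Se.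
Proof.
move=> H; split; first exact: Se0.
- apply: (env_ind hmh hAe).
  + move=> a; rewrite Deltae_m tmap_comp (eq_tmap (f' := m) (g' := m \o S)) //.
    rewrite -[tmap m (m \o S) _](tmap_comp m idfun m S) mult_tmap_m (antipoder hS).
    by rewrite linearZ /= (alg_hom1 (dg_alg_hom_graded hm)) -epse_m.
  + by move=> a; rewrite env_antipoder_h (antipode_br_swap hA H) linear0 epse_h scale0r.
  + by rewrite (alg_hom1 hD) (alg_hom1 he) tensor_oneE tmapE Defs.multE /= Se1 mulr1 scale1r.
  + by move=> c x y Hx Hy; rewrite !linearP /= Hx Hy scalerDl scalerA.
  + move=> x y Hx Hy; rewrite (alg_homM hD) (antipoder_mul Se0 anti_homM) Hy pureZl -tensor_oneE.
    by rewrite -scalerAr mulr1 !linearZ /= Hx scalerA (alg_homM he) mulrC.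
- apply: (env_ind hmh hAe).
  + move=> a; rewrite Deltae_m tmap_comp (eq_tmap (f' := m \o S) (g' := m)) //.
    rewrite -[tmap (m \o S) m _](tmap_comp m S m idfun) mult_tmap_m (antipodel hS).
    by rewrite linearZ /= (alg_hom1 (dg_alg_hom_graded hm)) -epse_m.
  + by move=> a; rewrite env_antipodel_h H linear0 epse_h scale0r.
  + by rewrite (alg_hom1 hD) (alg_hom1 he) tensor_oneE tmapE Defs.multE /= Se1 mulr1 scale1r.
  + by move=> c x y Hx Hy; rewrite !linearP /= Hx Hy scalerDl scalerA.
  + move=> x y Hx Hy; rewrite (alg_homM hD) (antipodel_mul Se0 anti_homM) Hx pureZr -tensor_oneE.
    by rewrite -scalerAl mul1r !linearZ /= Hy scalerA (alg_homM he).
Qed.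

(** For the converse, the left antipode axiom at h(a) reads m{S a1, a2} = 0, and
    [m] is injective. *)
Lemma env_hopf_iff :
  (forall a, br (tmap S idfun (Delta a)) = 0) <-> dg_hopf_algebra Deltae epse Se.
Proof.
split=> [H|[_ hSe'] a].
  split; last exact: env_is_antipode.
  exact: (env_dg_bialgebra hAe hB hDeltae hepse).
apply: (env_mul_inj hP hAe).
by rewrite -env_antipodel_h (antipodel hSe') epse_h scale0r.
Qed.

End Hopf.
End EnvAntipode.

Theorem theorem1p2 (k : fieldType) (char0 : [pchar k] =i pred0)
    (A : dgAlgType k)
    (Delta : {linear A -> tensor A A}) (eps : {linear A -> k^o}) (S : {linear A -> A})
    (br : {linear tensor A A -> A})
    (hA : dg_poisson_hopf_algebra Delta eps S br)
    (Ae : dgAlgType k) (m h : {linear A -> Ae})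
    (hAe : univ_env br m h)
    (Deltae : {linear Ae -> tensor Ae Ae}) (epse : {linear Ae -> k^o})
    (hDeltae : dg_alg_hom Deltae) (hepse : dg_alg_hom epse)
    (Deltae_m : forall a, Deltae (m a) = tmap m m (Delta a))
    (Deltae_h : forall a, Deltae (h a) = tmap m h (Delta a) + tmap h m (Delta a))
    (epse_m : forall a, epse (m a) = eps a)
    (epse_h : forall a, epse (h a) = 0) :
  (exists Se : {linear Ae -> Ae},
     [/\ dg_alg_hom (Se : Ae -> gop Ae),
         (forall a, Se (m a) = m (S a)) & (forall a, Se (h a) = h (S a))])
  /\
  (forall Se : {linear Ae -> Ae},
     [/\ dg_alg_hom (Se : Ae -> gop Ae),
         (forall a, Se (m a) = m (S a)) & (forall a, Se (h a) = h (S a))] ->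
     ((forall a, br (tmap S idfun (Delta a)) = 0)
      <-> dg_hopf_algebra Deltae epse Se)).
Proof.
split; first exact: (env_antipode_exists hA hAe).
move=> Se [hSe Se_m Se_h].
exact: (env_hopf_iff hA hAe hDeltae hepse Deltae_m Deltae_h epse_m epse_h hSe Se_m Se_h).
Qed.
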